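(* There exist a compact nondegenerate interval $I\subset\mathbb{R}$, a continuous map $S:I\to I$, and a Cantor set $K\subset I$ with $S(K)=K$ such that: (i) the global Milnor attractor $\Lambda(S)$ is the closure of a union of solenoids, each of which has a basin of attraction of zero Lebesgue measure; (ii) $\Lambda(S)$ carries zero topological entropy, i.e. $h_{\mathrm{top}}(S|_{\Lambda(S)})=0$; (iii) $K\cap\Lambda(S)=\emptyset$, $K$ has zero Lebesgue measure, and $K$ carries the full topological entropy of $S$, i.e. $h_{\mathrm{top}}(S|_K)=h_{\mathrm{top}}(S)>0$. In particular, $\Lambda(S)\subsetneq\Omega(S)$. Moreover, $S$ can be chosen so that, in addition, $\Lambda(S)$ has Hausdorff dimension zero.
   Context: For a continuous map $f:I\to I$ of a compact interval: $\omega(x)=\bigcap_{n\ge 0}\overline{\{f^m(x):m\ge n\}}$; a point $x$ is non-wandering if for every neighborhood $U$ of $x$ there is $n>0$ with $f^n(U)\cap U\neq\emptyset$, and $\Omega(f)$ is the set of non-wandering points. The global Milnor attractor $\Lambda(f)$ is the smallest closed set containing $\omega(x)$ for Lebesgue-almost all $x\in I$. The basin of attraction of a nonempty set $U\subset I$ is $B(U)=\{x\in I:\omega(x)\subseteq U\}$. An $\omega$-limit set $\omega(x)$ is a solenoid if $\omega(x)=\bigcap_{i=1}^\infty\bigcup_{j=1}^{k_i}I_{ij}$, where $I_{ij}$ ($i\in\mathbb{N}$, $1\le j\le k_i$) are closed intervals, the sequence $(k_i)$ is unbounded, $\bigcup_{j=1}^{k_i}I_{ij}\supset\bigcup_{j=1}^{k_{i+1}}I_{i+1,j}$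 for every $i$, $f(I_{ij})\subset I_{i,j+1}$ for all $i,j$ (second index taken mod $k_i$), and $\lim_{i\to\infty}\max_j\operatorname{diam}I_{ij}=0$. $h_{\mathrm{top}}$ denotes topological entropy. *)

(* Defs.v *)
From HB Require Import structures.
From mathcomp Require Import all_boot all_order all_algebra finmap.
From mathcomp Require Import all_classical all_reals all_analysis.

Set Implicit Arguments.
Unset Strict Implicit.
Unset Printing Implicit Defensive.

Import Order.TTheory GRing.Theory Num.Theory.
Import numFieldNormedType.Exports.

Local Open Scope classical_set_scope.
Local Open Scope ring_scope.

(* A self-map of the compact interval [I : set R] is a total function
   [f : R -> R], continuous within [I], with [f @` I `<=` I]; its values outside
   [I] are irrelevant.  Since [I] is closed, closures taken in [R] of subsets of
   [I] agree with those taken in [I]. *)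

Definition interval_map (R : realType) (I : set R) (f : R -> R) : Prop :=
  {within I, continuous f} /\ f @` I `<=` I.

Definition omega (R : realType) (f : R -> R) (x : R) : set R :=
  \bigcap_(n : nat) closure [set iter m f x | m in [set m : nat | (n <= m)%N]].

(* The neighbourhoods of [x] in [I] are the traces on [I] of those in [R]. *)
Definition nonwandering (R : realType) (I : set R) (f : R -> R) : set R :=
  [set x | I x /\ forall U : set R, nbhs x U ->
     exists2 n : nat, (0 < n)%N & (iter n f @` (U `&` I)) `&` U !=set0].

Definition attracts_ae (R : realType) (I : set R) (f : R -> R) (A : set R) :
    Prop :=
  [/\ closed A, A `<=` I &
      {ae @lebesgue_measure R, forall x, I x -> omega f x `<=` A}].

Definition is_milnor_attractor (R : realType) (I : set R) (f : R -> R)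
    (L : set R) : Prop :=
  attracts_ae I f L /\ forall A, attracts_ae I f A -> L `<=` A.

Definition basin (R : realType) (I : set R) (f : R -> R) (U : set R) : set R :=
  [set x | I x /\ omega f x `<=` U].

(* The intervals of level [i] are [`[l i j, u i j]] for [j < k i]; the second
   index runs from 0, and intervals are nondegenerate.  Intervals of the same
   level are not required to be pairwise disjoint. *)
Definition solenoid (R : realType) (I : set R) (f : R -> R) (A : set R) : Prop :=
  (exists2 x, I x & A = omega f x) /\
  exists (k : nat -> nat) (l u : nat -> nat -> R),
    let J i j := `[l i j, u i j]%classic in
    let level i := \bigcup_(j in [set j : nat | (j < k i)%N]) J i j in
    [/\ forall i, (0 < k i)%N,
        forall i j, (j < k i)%N -> l i j < u i j /\ J i j `<=` I,
        A = \bigcap_(i : nat) level i &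
    [/\ forall N : nat, exists i, (N < k i)%N,
        forall i, level i.+1 `<=` level i,
        forall i j, (j < k i)%N -> f @` J i j `<=` J i (j.+1 %% k i)%N &
        (fun i => \big[Num.max/0]_(j < k i) (u i j - l i j)) @ \oo --> (0 : R)]].

Definition cantor_set (R : realType) (K : set R) : Prop :=
  [/\ K !=set0, compact K, perfect_set K & totally_disconnected K].

(* Bowen's definition of topological entropy: [E] is (n, e)-separated if any two
   distinct points of [E] are more than [e] apart at some time [k < n]. *)
Definition separated (R : realType) (f : R -> R) (n : nat) (e : R)
    (E : {fset R}) : Prop :=
  forall x y, x \in E -> y \in E -> x != y ->
    exists2 k : nat, (k < n)%N & e < `|iter k f x - iter k f y|.

Definition log_max_separated (R : realType) (f : R -> R) (A : set R) (n : nat)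
    (e : R) : \bar R :=
  ereal_sup [set (ln (#|` E|%:R : R))%:E |
               E in [set E : {fset R} | [set` E] `<=` A /\ separated f n e E]].

(* The growth rate is nonincreasing in [e], so that the supremum over [e > 0] is
   the limit as [e] tends to 0.  For [f @` A `<=` A] this is the entropy of the
   restriction of [f] to [A]. *)
Definition htop (R : realType) (f : R -> R) (A : set R) : \bar R :=
  ereal_sup [set limn_esup (fun n : nat =>
                   ((n%:R : R)^-1%:E * log_max_separated f A n e)%E) |
               e in [set e : R | 0 < e]].

(* The point 0 is adjoined so that the diameter of the empty set is 0. *)
Definition diam (R : realType) (U : set R) : \bar R :=
  ereal_sup (0%E |` [set `|p.1 - p.2|%:E | p in U `*` U]).

Definition hausdorff_premeasure (R : realType) (s d : R) (A : set R) : \bar R :=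
  ereal_inf [set (\sum_(0 <= i <oo) (diam (U i) `^ s))%E |
               U in [set U : nat -> set R |
                 A `<=` \bigcup_i U i /\ forall i, (diam (U i) <= d%:E)%E]].

Definition hausdorff_measure (R : realType) (s : R) (A : set R) : \bar R :=
  ereal_sup [set hausdorff_premeasure s d A | d in [set d : R | 0 < d]].

(* Only [s > 0] is used: [0 `^ 0 = 1] would count empty sets of a cover. *)
Definition hausdorff_dim (R : realType) (A : set R) : \bar R :=
  ereal_inf [set s%:E | s in [set s : R | 0 < s /\ hausdorff_measure s A = 0%E]].

(* Main.v *)
Require Import Defs.
From mathcomp Require Import all_boot all_order all_algebra finmap.
From mathcomp Require Import all_classical all_reals all_analysis.
From mathcomp Require Import measurable_realfun ring lra zify.

Set Implicit Arguments.
Unset Strict Implicit.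
Unset Printing Implicit Defensive.

Import Order.TTheory GRing.Theory Num.Theory.
Import numFieldNormedType.Exports.

Local Open Scope classical_set_scope.
Local Open Scope ring_scope.

(** The map [S] acts on the segment from [0] to [7 / 2]. Its attractor lives in
    the unit interval and its entropy above [2].

    In the unit interval, [S] is the bottom of a tower of maps [tower n] of the
    unit interval, each of which is renormalised by the next. The map of level
    [n] has four disjoint intervals of length [level_ratio n], in two pairs. One
    interval of a pair is translated onto the other, which returns to the first
    through a copy of [tower n.+1]; the second pair is the mirror image of the
    first. On the three gaps between them the map is affine and expanding. Hence
    the intervals of depth [k], indexed by words of length [k] over the pairs
    (pair, position), are permuted by the carry of a binary odometer on the
    positions, while the choice of the pairs is preserved. The points that lie
    in intervals of every depth form the attractor [L]; an infinite word selects
    a solenoid in it, on which [S] acts as an odometer. The maps are limits of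
    piecewise affine ones, and are Lipschitz with constant [9 / 5].

    Almost every point reaches every depth. In the unit interval all but
    countably many do ([countable_avoiding]): an orbit that stays in the gaps is
    trapped at one of three repelling fixed points, and the map is injective over
    each gap. Above [1] the same holds outside the horseshoe [K], since [S] has
    finitely many monotone pieces there ([negligible_unreached]). Therefore [L]
    attracts almost every point. It is minimal, because an orbit returns to each
    interval that it meets, and each interval has positive measure.

    Many solenoids have null basins. The two ways to extend a word by one more
    choice of pair give cycles that capture disjoint sets of points, so one of
    them captures at most half of what the word captures ([mass_half]). Taking
    this choice forever, from any given word on, yields a solenoid which meets
    the interval of that word and whose basin is null. These solenoids are dense
    in [L].

    The entropy on [L] vanishes, since points in a common small interval are
    never separated. Its dimension vanishes, since there are [4 ^ k] intervals of
    depth [k], of length [8 ^ - (k * (k + 1))].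

    Above [2] the map is a tent map of slope [3], whose maximal invariant set [K]
    in the segment from [2] to [3] is the middle-third Cantor set. Its points
    realise all words of length [n] in two letters, so its entropy is at least
    [ln 2]. Conversely, the cardinality of a separated set is controlled by the
    variations of the iterates ([card_separated_le]). The part above [2] is
    folded twice over itself and the rest has Lipschitz constant less than [2],
    so the variation of the [k]-th iterate is [O (2 ^ k)]: the entropy of [S] is
    exactly [ln 2], and it is carried by [K]. *)

(** * Splicing Lipschitz functions *)

Definition splice (R : realType) (a : R) (f g : R -> R) (x : R) : R :=
  if x <= a then f x else g x.

Definition lip (R : realType) (k : R) (f : R -> R) : Prop :=
  forall x y, `|f x - f y| <= k * `|x - y|.

Lemma lip_le (R : realType) (k : R) (f : R -> R) :
  (forall x y, x <= y -> `|f x - f y| <= k * (y - x)) -> lip k f.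
Proof.
move=> h x y; have [xy|yx] := leP x y.
  by rewrite [X in _ * X]distrC (ger0_norm (_ : 0 <= y - x)) ?subr_ge0 // h.
by rewrite distrC (ger0_norm (_ : 0 <= x - y)) ?subr_ge0 ?h // ltW.
Qed.

Lemma lip_splice (R : realType) (k a : R) (f g : R -> R) :
  lip k f -> lip k g -> f a = g a -> lip k (splice a f g).
Proof.
move=> lf lg fga; apply: lip_le => x y xy; rewrite /splice.
have E (u v : R) : u <= v -> `|u - v| = v - u.
  by move=> uv; rewrite distrC ger0_norm ?subr_ge0.
case: ifPn => xa; case: ifPn => ya.
- by rewrite -(E x y) //; exact: lf.
- rewrite -ltNge in ya; have := lf x a; have := lg a y.
  rewrite -fga (E x a) // (E a y) ?(ltW ya) // => h1 h2.
  by apply: (le_trans (ler_distD (f a) (f x) (g y))); lra.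
- by rewrite -ltNge in xa; lra.
- by rewrite -(E x y) //; exact: lg.
Qed.

Lemma lip_affine (R : realType) (k s c : R) : `|s| <= k -> lip k (fun x => s * x + c).
Proof.
move=> sk x y; rewrite opprD addrACA subrr addr0 -mulrBr normrM.
exact: ler_wpM2r.
Qed.

Lemma lip_continuous (R : realType) (k : R) (f : R -> R) : lip k f -> continuous f.
Proof.
move=> lf x; apply/cvgrPdist_le => e e0.
pose k' := Num.max k 1.
have k'0 : 0 < k' by rewrite lt_max ltr01 orbT.
near=> y.
apply: (le_trans (lf x y)).
apply: (@le_trans _ _ (k' * `|x - y|)).
  by rewrite ler_wpM2r// le_max lexx.
rewrite mulrC -ler_pdivlMr//.
near: y; apply: cvgr_dist_le => //; exact: divr_gt0.
Unshelve. all: by end_near.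
Qed.

(** * One renormalisation step *)

(** The affine function of slope [slope0 r] joins the points [(r, 1/5 + r)] and
    [(1/5, r/5)], and that of slope [slope1 r] the points [(1/5 + r, 4r/5)] and
    [(1/2, 1/2)]. *)
Definition slope0 (R : realType) (r : R) : R := - (5^-1 + r - r / 5) / (5^-1 - r).
Definition icpt0 (R : realType) (r : R) : R := 5^-1 + r - slope0 r * r.
Definition slope1 (R : realType) (r : R) : R := (2^-1 - r * (4 / 5)) / (3 / 10 - r).
Definition icpt1 (R : realType) (r : R) : R := 2^-1 - slope1 r * 2^-1.

(** The two intervals of the left pair start at [0] and [1/5]. The values of [U]
    that the pieces must match are [U 0 = 1/5] and [U 1 = 4/5]. *)
Definition left_half (R : realType) (r : R) (U : R -> R) : R -> R :=
  splice r (fun x => 1 * x + 5^-1)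
    (splice 5^-1 (fun x => slope0 r * x + icpt0 r)
      (splice (5^-1 + r) (fun x => r * U ((x - 5^-1) / r))
        (fun x => slope1 r * x + icpt1 r))).

(** The map of the unit interval, symmetric about [1/2], whose square acts on
    each of four intervals of length [r] as a copy of [U]. *)
Definition step (R : realType) (r : R) (U : R -> R) : R -> R :=
  splice 2^-1 (left_half r U) (fun x => 1 - left_half r U (1 - x)).

Section Step.
Variables (R : realType) (r : R) (U : R -> R).
Hypotheses (r0 : 0 < r) (r1 : r <= 64^-1).
Hypotheses (U0 : U 0 = 5^-1) (U1 : U 1 = 4 / 5).

Local Ltac rlra := have ? := r0; have ? := r1; lra.
Local Ltac rnra := have ? := r0; have ? := r1; nra.

Lemma slope0_bound : - (6 / 5) <= slope0 r < - 1.
Proof.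
rewrite /slope0; have d : 0 < 5^-1 - r by rlra.
by rewrite ler_pdivlMr // ltr_pdivrMr //; apply/andP; split; rlra.
Qed.

Lemma slope1_bound : 1 < slope1 r <= 9 / 5.
Proof.
rewrite /slope1; have d : 0 < 3 / 10 - r by rlra.
by rewrite ler_pdivrMr // ltr_pdivlMr //; apply/andP; split; rlra.
Qed.

Lemma icpt0_left : slope0 r * r + icpt0 r = 5^-1 + r.
Proof. by rewrite /icpt0; rlra. Qed.

Lemma icpt0_right : slope0 r * 5^-1 + icpt0 r = r / 5.
Proof.
rewrite /icpt0 /slope0; have d : 5^-1 - r != 0 by apply: lt0r_neq0; rlra.
by field; move: d; apply: contraNneq => e; rlra.
Qed.

Lemma icpt1_left : slope1 r * (5^-1 + r) + icpt1 r = r * (4 / 5).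
Proof.
rewrite /icpt1 /slope1; have d : 3 / 10 - r != 0 by apply: lt0r_neq0; rlra.
by field; move: d; apply: contraNneq => e; rlra.
Qed.

Lemma icpt1_right : slope1 r * 2^-1 + icpt1 r = 2^-1.
Proof. by rewrite /icpt1; rlra. Qed.

Lemma left_half_translation x : x <= r -> left_half r U x = x + 5^-1.
Proof. by move=> h; rewrite /left_half /splice h mul1r. Qed.

Lemma left_half_gap x : r <= x <= 5^-1 -> left_half r U x = slope0 r * x + icpt0 r.
Proof.
move=> /andP[rx x5]; rewrite /left_half /splice x5; case: ifPn => // xr.
have -> : x = r by apply/eqP; rewrite eq_le xr.
by rewrite icpt0_left; rlra.
Qed.

Lemma left_half_renorm x : 5^-1 <= x <= 5^-1 + r -> left_half r U x = r * U ((x - 5^-1) / r).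
Proof.
move=> /andP[rx x5]; rewrite /left_half /splice x5; case: ifPn => [xr|_]; first by rlra.
case: ifPn => // xr; have -> : x = 5^-1 by apply/eqP; rewrite eq_le xr.
by rewrite icpt0_right subrr mul0r U0.
Qed.

Lemma left_half_middle x : 5^-1 + r <= x -> left_half r U x = slope1 r * x + icpt1 r.
Proof.
move=> rx; rewrite /left_half /splice; case: ifPn => [xr|_]; first by rlra.
case: ifPn => [xr|_]; first by rlra.
case: ifPn => // xr; have -> : x = 5^-1 + r by apply/eqP; rewrite eq_le xr.
by rewrite icpt1_left [5^-1 + r]addrC addrK divff ?gt_eqF // U1.
Qed.

Lemma left_half_half : left_half r U 2^-1 = 2^-1.
Proof. by rewrite left_half_middle ?icpt1_right; rlra. Qed.

Lemma step_left_half x : x <= 2^-1 -> step r U x = left_half r U x.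
Proof. by rewrite /step /splice => ->. Qed.

Lemma step_sym x : step r U (1 - x) = 1 - step r U x.
Proof.
rewrite /step /splice; case: ifPn => h1; case: ifPn => h2.
- have -> : x = 2^-1 by rlra.
  have -> : 1 - 2^-1 = 2^-1 :> R by rlra.
  by rewrite left_half_half; rlra.
- by rewrite subKr.
- by rewrite subKr.
- by rlra.
Qed.

Lemma step_middle x : 5^-1 + r <= x <= 4 / 5 - r ->
  step r U x = slope1 r * x + icpt1 r.
Proof.
move=> /andP[h1 h2]; case: (leP x 2^-1) => h.
  by rewrite step_left_half // left_half_middle.
rewrite -[x](subKr 1) step_sym step_left_half; last by rlra.
rewrite left_half_middle; last by rlra.
by have := icpt1_right; rlra.
Qed.

(** Rescaling the argument and the values by the same ratio keeps the Lipschitz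
    constant of [U], and the gaps are long enough to keep the affine pieces
    below it. *)
Lemma lip_left_half : lip (9 / 5) U -> lip (9 / 5) (left_half r U).
Proof.
move=> lU; have s0 := slope0_bound; have s1 := slope1_bound.
apply: lip_splice; first by apply: lip_affine; rewrite normr1; rlra.
- apply: lip_splice; first by apply: lip_affine; rewrite ler0_norm; rlra.
  + apply: lip_splice.
    * move=> x y; rewrite -mulrBr normrM gtr0_norm //.
      apply: le_trans (ler_wpM2l (ltW r0) (lU _ _)) _.
      have rN0 : r != 0 by rewrite gt_eqF.
      have -> : (x - 5^-1) / r - (y - 5^-1) / r = (x - y) / r by field.
      rewrite normrM normfV (gtr0_norm r0) mulrCA [r * _]mulrC.
      by rewrite divfK.
    * by apply: lip_affine; rewrite ger0_norm; rlra.
    * by rewrite icpt1_left [5^-1 + r]addrC addrK divff ?gt_eqF // U1.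
  + by rewrite /splice ifT ?icpt0_right ?subrr ?mul0r ?U0; rlra.
- by rewrite /splice ifT ?icpt0_left; rlra.
Qed.

Lemma lip_step : lip (9 / 5) U -> lip (9 / 5) (step r U).
Proof.
move=> lU; have lH := lip_left_half lU; apply: lip_splice => //.
- move=> x y.
  have -> : 1 - left_half r U (1 - x) - (1 - left_half r U (1 - y)) =
    left_half r U (1 - y) - left_half r U (1 - x) by ring.
  by apply: le_trans (lH _ _) _; have -> : 1 - y - (1 - x) = x - y by ring.
- have -> : 1 - 2^-1 = 2^-1 :> R by rlra.
  by rewrite left_half_half; rlra.
Qed.

Lemma step0 : step r U 0 = 5^-1.
Proof. by rewrite step_left_half ?left_half_translation ?add0r // ltW. Qed.

Lemma step1 : step r U 1 = 4 / 5.
Proof. by have := step_sym 0; rewrite subr0 step0 => ->; lra. Qed.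

Lemma left_half_range : (forall x, 0 <= x <= 1 -> 0 <= U x <= 1) ->
  forall x, 0 <= x <= 2^-1 -> 0 <= left_half r U x <= 1.
Proof.
move=> hU x /andP[x0 x2]; have s0 := slope0_bound; have s1 := slope1_bound.
have i0 := icpt0_left; have i0' := icpt0_right.
have i1 := icpt1_left; have i1' := icpt1_right.
case: (leP x r) => xr; first by rewrite left_half_translation //; rlra.
case: (leP x 5^-1) => x5.
  rewrite left_half_gap ?x5 ?(ltW xr) //; apply/andP; split; rnra.
case: (leP x (5^-1 + r)) => x5r.
  rewrite left_half_renorm ?x5r ?(ltW x5) //.
  have /hU/andP[u0 u1] : 0 <= (x - 5^-1) / r <= 1.
    by rewrite ler_pdivlMr // mul0r ler_pdivrMr // mul1r; rlra.
  rewrite mulr_ge0 ?(ltW r0) //=.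
  by have := ler_wpM2l (ltW r0) u1; rlra.
rewrite left_half_middle ?(ltW x5r) //; apply/andP; split; rnra.
Qed.

Lemma step_range : (forall x, 0 <= x <= 1 -> 0 <= U x <= 1) ->
  forall x, 0 <= x <= 1 -> 0 <= step r U x <= 1.
Proof.
move=> hU x /andP[x0 x1]; case: (leP x 2^-1) => h.
  by rewrite step_left_half // left_half_range // x0.
rewrite -[x](subKr 1) step_sym step_left_half; last by rlra.
have : 0 <= left_half r U (1 - x) <= 1 by apply: left_half_range => //; lra.
by lra.
Qed.

End Step.

(** * The tower of maps *)

(** The ratios tend to [0] with the level: this makes the dimension of the
    attractor vanish. *)
Definition level_ratio (R : realType) (n : nat) : R := 64^-1 ^+ n.+1.

Lemma level_ratio_gt0 (R : realType) n : 0 < level_ratio R n.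
Proof. by rewrite exprn_gt0 // invr_gt0. Qed.

Lemma level_ratio_le (R : realType) n : level_ratio R n <= 64^-1.
Proof. by rewrite /level_ratio exprS ler_piMr ?exprn_ile1 //; lra. Qed.

(** The approximation of depth [m] to the map of level [n], which ends with an
    affine map with the required values at [0] and [1]. *)
Fixpoint approx (R : realType) (m n : nat) : R -> R :=
  if m is m'.+1 then step (level_ratio R n) (@approx R m' n.+1)
  else splice 0 (fun x => 1 * x + 5^-1)
         (splice 1 (fun x => 3 / 5 * x + 5^-1) (fun x => 1 * x + - 5^-1)).

Arguments approx R m n x : clear implicits.

Lemma approx_endpoints (R : realType) m n :
  approx R m n 0 = 5^-1 /\ approx R m n 1 = 4 / 5.
Proof.
elim: m n => [|m IH] n /=.
  by rewrite /splice lexx ler10 lexx; split; lra.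
have [e0 e1] := IH n.+1; have r0 := level_ratio_gt0 R n; have r1 := level_ratio_le R n.
by split; [exact: step0|exact: step1].
Qed.

Lemma approx_lip (R : realType) m n : lip (9 / 5) (approx R m n).
Proof.
elim: m n => [|m IH] n /=.
  have l1 c : lip (9 / 5) (fun x : R => 1 * x + c).
    by apply: lip_affine; rewrite normr1; lra.
  apply: lip_splice; [exact: l1| |by rewrite /splice ler01; lra].
  apply: lip_splice; [|exact: l1|lra].
  by apply: lip_affine; rewrite ger0_norm; lra.
have [e0 e1] := approx_endpoints R m n.+1.
by apply: lip_step; rewrite ?level_ratio_gt0 ?level_ratio_le.
Qed.

Lemma approx_range (R : realType) m n (x : R) : 0 <= x <= 1 ->
  0 <= approx R m n x <= 1.
Proof.
elim: m n x => [|m IH] n x x01 /=.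
  by rewrite /splice; case: ifPn => ?; last case: ifPn => ?; lra.
have [e0 e1] := approx_endpoints R m n.+1.
by apply: step_range; rewrite ?level_ratio_gt0 ?level_ratio_le // => y; exact: IH.
Qed.

(** Changing the renormalised map by at most [e] on [[0, 1]] changes the map by
    at most half as much: the argument is rescaled, and lands in [[0, 1]]. *)
Lemma left_half_near (R : realType) (r e : R) (U V : R -> R) : 0 < r -> r <= 64^-1 ->
  (forall x, 0 <= x <= 1 -> `|U x - V x| <= e) ->
  forall x, `|left_half r U x - left_half r V x| <= e / 2.
Proof.
move=> r0 r1 UV x.
have e0 : 0 <= e by have := UV 0; rewrite lexx ler01 => /(_ isT); apply: le_trans.
have e20 : 0 <= e / 2 by rewrite divr_ge0.
rewrite /left_half /splice; case: ifPn => h1; first by rewrite subrr normr0.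
case: ifPn => h2; first by rewrite subrr normr0.
case: ifPn => h3; last by rewrite subrr normr0.
rewrite -mulrBr normrM gtr0_norm //.
have /UV : 0 <= (x - 5^-1) / r <= 1.
  by rewrite ler_pdivlMr // mul0r ler_pdivrMr // mul1r; lra.
move=> /(ler_wpM2l (ltW r0)) /le_trans; apply; nra.
Qed.

Lemma step_near (R : realType) (r e : R) (U V : R -> R) : 0 < r -> r <= 64^-1 ->
  (forall x, 0 <= x <= 1 -> `|U x - V x| <= e) ->
  forall x, `|step r U x - step r V x| <= e / 2.
Proof.
move=> r0 r1 UV x; rewrite /step /splice; case: ifPn => h1.
  exact: left_half_near.
have -> : 1 - left_half r U (1 - x) - (1 - left_half r V (1 - x)) =
  left_half r V (1 - x) - left_half r U (1 - x) by ring.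
by rewrite distrC; exact: left_half_near.
Qed.

Lemma approx_near (R : realType) m n (x : R) : 0 <= x <= 1 ->
  `|approx R m n x - approx R m.+1 n x| <= 2^-1 ^+ m.
Proof.
elim: m n x => [|m IH] n x x01.
  have := approx_range 0 n x01; have := approx_range 1 n x01.
  by rewrite expr0 ler_norml; lra.
rewrite exprSr; apply: step_near; rewrite ?level_ratio_gt0 ?level_ratio_le // => y.
exact: IH.
Qed.

Lemma approx_nearS (R : realType) m n (x : R) :
  `|approx R m.+1 n x - approx R m.+2 n x| <= 2^-1 ^+ m.
Proof.
have e0 : 0 <= 2^-1 ^+ m :> R by rewrite exprn_ge0.
apply: (@le_trans _ _ (2^-1 ^+ m / 2)); last by lra.
apply: step_near; rewrite ?level_ratio_gt0 ?level_ratio_le // => y; exact: approx_near.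
Qed.

Definition tower (R : realType) (n : nat) (x : R) : R :=
  limn (fun m => approx R m n x).

Lemma approx_cvg (R : realType) n (x : R) :
  approx R m n x @[m --> \oo] --> tower n x.
Proof.
pose u m := approx R m.+1 n x.
have : cvgn (series (telescope u)).
  apply: normed_cvg; apply: (@series_le_cvg _ _ (geometric 1 2^-1)).
  - by move=> k /=.
  - by move=> k /=; rewrite mul1r exprn_ge0.
  - by move=> k /=; rewrite mul1r /telescope distrC approx_nearS.
  - by apply: is_cvg_geometric_series; rewrite ger0_norm; lra.
rewrite telescopeK => cu.
have : cvgn u.
  have -> : u = (u - cst (u 0)) + cst (u 0) by rewrite subrK.
  by apply: is_cvgD => //; exact: is_cvg_cst.
move=> /cvg_ex[l ul]; suff : cvgn (fun m => approx R m n x) by [].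
by apply/cvg_ex; exists l; rewrite -cvg_shiftS.
Qed.

Lemma step_cvg (R : realType) (r : R) (U : nat -> R -> R) (V : R -> R) x :
  (forall y, U m y @[m --> \oo] --> V y) ->
  step r (U m) x @[m --> \oo] --> step r V x.
Proof.
move=> UV; have half_cvg y : left_half r (U m) y @[m --> \oo] --> left_half r V y.
  rewrite /left_half /splice; case: ifPn => _; first exact: cvg_cst.
  case: ifPn => _; first exact: cvg_cst.
  case: ifPn => _; last exact: cvg_cst.
  by apply: cvgMr; exact: UV.
rewrite /step /splice; case: ifPn => _; first exact: half_cvg.
by apply: cvgB; [exact: cvg_cst|exact: half_cvg].
Qed.

Lemma towerE (R : realType) n (x : R) :
  tower n x = step (level_ratio R n) (@tower R n.+1) x.
Proof.
have h1 : approx R m.+1 n x @[m --> \oo] --> tower n x.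
  by rewrite (cvg_shiftS (fun m => approx R m n x)); exact: approx_cvg.
have h2 : approx R m.+1 n x @[m --> \oo] --> step (level_ratio R n) (@tower R n.+1) x.
  by apply: step_cvg => y; exact: approx_cvg.
by rewrite -(cvg_lim _ h1) // -(cvg_lim _ h2).
Qed.

Lemma tower0 (R : realType) n : tower n (0 : R) = 5^-1.
Proof.
by apply: cvg_lim => //; under eq_fun do rewrite (approx_endpoints R _ n).1; exact: cvg_cst.
Qed.

Lemma tower1 (R : realType) n : tower n (1 : R) = 4 / 5.
Proof.
by apply: cvg_lim => //; under eq_fun do rewrite (approx_endpoints R _ n).2; exact: cvg_cst.
Qed.

Lemma tower_lip (R : realType) n : lip (9 / 5) (@tower R n).
Proof.
move=> x y; have c : `|approx R m n x - approx R m n y| @[m --> \oo] -->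
    `|tower n x - tower n y|.
  by apply: cvg_norm; apply: cvgB; exact: approx_cvg.
rewrite -(cvg_lim _ c) //; apply: limr_le; first by apply/cvg_ex; eexists; exact: c.
by apply: nearW => m; exact: approx_lip.
Qed.

Lemma tower_range (R : realType) n (x : R) : 0 <= x <= 1 -> 0 <= tower n x <= 1.
Proof.
move=> x01; have c := @approx_cvg R n x.
have cv : cvgn (fun m => approx R m n x) by apply/cvg_ex; eexists; exact: c.
by apply/andP; split; [apply: limr_ge|apply: limr_le] => //; apply: nearW => m;
  case/andP: (approx_range m n x01).
Qed.

Section Tower.
Variables (R : realType) (n : nat).
Local Notation r := (level_ratio R n).

Let r0 : 0 < r. Proof. exact: level_ratio_gt0. Qed.
Let r1 : r <= 64^-1. Proof. exact: level_ratio_le. Qed.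
Let U0 := tower0 R n.+1.
Let U1 := tower1 R n.+1.

Lemma tower_sym (x : R) : tower n (1 - x) = 1 - tower n x.
Proof. by rewrite !towerE step_sym. Qed.

Lemma tower_gap (x : R) : r <= x <= 5^-1 -> tower n x = slope0 r * x + icpt0 r.
Proof.
by move=> /[dup] xI /andP[_ x5]; rewrite towerE step_left_half ?left_half_gap //; lra.
Qed.

Lemma tower_middle (x : R) : 5^-1 + r <= x <= 4 / 5 - r ->
  tower n x = slope1 r * x + icpt1 r.
Proof. by move=> xI; rewrite towerE step_middle. Qed.

End Tower.

(** The left end of the subinterval with digits [c] of the unit interval when
    the subintervals have length [r]: [c.1] selects the half of the unit
    interval, and [c.2] the position in that half, counted from the outside. *)
Definition offset (R : realType) (r : R) (c : bool * bool) : R :=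
  let q := if c.2 then 5^-1 else 0 in if c.1 then 1 - q - r else q.

Definition zoom (R : realType) (r : R) (c : bool * bool) (y : R) : R :=
  offset r c + r * y.

(** The odometer: the position [c.2] is incremented, and the carry, when there
    is one, acts through the map of the next level. *)
Lemma zoom_tower (R : realType) n c (y : R) : 0 <= y <= 1 ->
  tower n (zoom (level_ratio R n) c y) =
  zoom (level_ratio R n) (c.1, ~~ c.2) (if c.2 then tower n.+1 y else y).
Proof.
have r0 := level_ratio_gt0 R n; have r1 := level_ratio_le R n.
have U0 := tower0 R n.+1; have U1 := tower1 R n.+1.
have left d z : 0 <= z <= 1 -> tower n (zoom (level_ratio R n) (false, d) z) =
    zoom (level_ratio R n) (false, ~~ d) (if d then tower n.+1 z else z).
  move=> /andP[z0 z1]; rewrite towerE /zoom /offset /=.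
  have rz0 : 0 <= level_ratio R n * z by rewrite mulr_ge0 // ltW.
  have rz1 : level_ratio R n * z <= level_ratio R n by rewrite ler_piMr // ltW.
  case: d => /=; rewrite step_left_half; try lra.
    rewrite left_half_renorm //; last by lra.
    have -> : (5^-1 + level_ratio R n * z - 5^-1) / level_ratio R n = z by field; rewrite gt_eqF.
    by rewrite add0r.
  by rewrite left_half_translation // add0r // addrC.
case: c => [[] d] y01 //; last exact: left.
have zs e z : zoom (level_ratio R n) (true, e) z = 1 - zoom (level_ratio R n) (false, e) (1 - z).
  by rewrite /zoom /offset /=; ring.
rewrite zs tower_sym left; last by lra.
by rewrite zs; congr (1 - zoom _ _ _); case: d => //=; rewrite tower_sym.
Qed.

(** * Words and intervals *)

(** The action of the tower on words: the odometer on the second components,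
    least significant first. *)
Fixpoint carry (w : seq (bool * bool)) : seq (bool * bool) :=
  if w is c :: v then (c.1, ~~ c.2) :: (if c.2 then carry v else v) else [::].

Lemma size_carry w : size (carry w) = size w.
Proof. by elim: w => //= -[b []] v IH //=; rewrite IH. Qed.

Lemma size_iter_carry j w : size (iter j carry w) = size w.
Proof. by elim: j => //= j; rewrite size_carry. Qed.

Lemma map_fst_carry w : map fst (carry w) = map fst w.
Proof. by elim: w => //= -[b []] v IH //=; rewrite IH. Qed.

Lemma map_fst_iter_carry j w : map fst (iter j carry w) = map fst w.
Proof. by elim: j => //= j <-; rewrite map_fst_carry. Qed.

Lemma take_carry k w : take k (carry w) = carry (take k w).
Proof. by elim: k w => [|k IH] [|[b []] v] //=; rewrite ?IH. Qed.

Lemma take_iter_carry j k w : take k (iter j carry w) = iter j carry (take k w).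
Proof. by elim: j => //= j <-; rewrite take_carry. Qed.

Lemma iter_double (T : Type) (f : T -> T) j x :
  iter (2 * j) f x = iter j (fun y => f (f y)) x.
Proof. by elim: j => // j IH; rewrite mulnS !addnE /= IH. Qed.

(** Adding a unit twice moves a word on by a unit beyond its first letter, so
    that the period doubles with each letter. *)
Lemma iter_carry_period w : iter (2 ^ size w) carry w = w.
Proof.
elim: w => //= c v IH; rewrite expnS iter_double -[in RHS]IH.
by elim: (2 ^ size v)%N => //= j ->; case: c => -[] [].
Qed.

Lemma iter_carry_mod j w : iter (j %% 2 ^ size w) carry w = iter j carry w.
Proof.
rewrite [in RHS](divn_eq j (2 ^ size w)) addnC iterD; congr iter.
by elim: (_ %/ _)%N => //= k IH; rewrite mulSn iterD -IH iter_carry_period.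
Qed.

Fixpoint corner (R : realType) (n : nat) (w : seq (bool * bool)) : R :=
  if w is c :: v then zoom (level_ratio R n) c (@corner R n.+1 v) else 0.
Arguments corner R n w : clear implicits.

Fixpoint width (R : realType) (n k : nat) : R :=
  if k is k'.+1 then level_ratio R n * @width R n.+1 k' else 1.
Arguments width R n k : clear implicits.

Definition node (R : realType) (n : nat) (w : seq (bool * bool)) : set R :=
  `[corner R n w, corner R n w + width R n (size w)]%classic.
Arguments node R n w : clear implicits.

Lemma width_gt0 (R : realType) n k : 0 < width R n k.
Proof. by elim: k n => //= k IH n; rewrite mulr_gt0 ?level_ratio_gt0. Qed.

Lemma widthE (R : realType) n k :
  width R n k = 64^-1 ^+ (k * n) * 8^-1 ^+ (k * k.+1).
Proof.
elim: k n => [|k IH] n /=; first by rewrite !mul0n !expr0 mulr1.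
rewrite IH /level_ratio mulrA -exprD (_ : 64^-1 = 8^-1 ^+ 2 :> R); last first.
  by rewrite expr2 -invfM -natrM.
rewrite -!exprM -!exprD; congr (_ ^+ _); nia.
Qed.

Lemma width0_le (R : realType) k : width R 0 k <= 8^-1 ^+ k.
Proof.
rewrite widthE muln0 expr0 mul1r; apply: ler_wiXn2l; [by []|lra|nia].
Qed.

Lemma width0_small (R : realType) (e : R) : 0 < e -> exists k, width R 0 k < e.
Proof.
move=> e0; have : (8^-1 : R) ^+ k @[k --> \oo] --> (0 : R).
  by apply: cvg_expr; rewrite ger0_norm; lra.
move=> /cvgrPdist_lt/(_ _ e0)[k _ /(_ k (leqnn k))] /=.
rewrite sub0r normrN ger0_norm ?exprn_ge0 // => h; exists k.
exact: le_lt_trans (width0_le R k) h.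
Qed.

Lemma zoom_itv (R : realType) (r : R) c y : 0 < r -> r <= 64^-1 ->
  0 <= y <= 1 -> 0 <= zoom r c y <= 1.
Proof.
move=> r0 r1 /andP[y0 y1].
have ry0 : 0 <= r * y by rewrite mulr_ge0 // ltW.
have ry1 : r * y <= r by rewrite ler_piMr // ltW.
by case: c => -[] []; rewrite /zoom /offset /=; lra.
Qed.

Lemma zoom_inj (R : realType) (r : R) c d y z : 0 < r -> r <= 64^-1 ->
  0 <= y <= 1 -> 0 <= z <= 1 -> zoom r c y = zoom r d z -> c = d /\ y = z.
Proof.
move=> r0 r1 /andP[y0 y1] /andP[z0 z1] e.
have ry0 : 0 <= r * y by rewrite mulr_ge0 // ltW.
have ry1 : r * y <= r by rewrite ler_piMr // ltW.
have rz0 : 0 <= r * z by rewrite mulr_ge0 // ltW.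
have rz1 : r * z <= r by rewrite ler_piMr // ltW.
suff cd : c = d.
  split=> //; move: e; rewrite cd => /addrI; apply: mulfI.
  by rewrite gt_eqF.
by move: e; case: c => -[] []; case: d => -[] []; rewrite /zoom /offset //= => e; exfalso; lra.
Qed.

Lemma nodeP (R : realType) n c v (x : R) :
  node R n (c :: v) x <-> exists2 y, node R n.+1 v y & x = zoom (level_ratio R n) c y.
Proof.
have r0 := level_ratio_gt0 R n.
rewrite /node /= !in_itv /= /zoom; split.
  move=> /andP[h1 h2]; exists ((x - offset (level_ratio R n) c) / level_ratio R n).
    rewrite /= in_itv /= ler_pdivlMr // ler_pdivrMr //.
    by apply/andP; split; rewrite mulrC; lra.
  by field; rewrite gt_eqF.
move=> [y]; rewrite /= in_itv /= => /andP[h1 h2] ->.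
by rewrite !lerD2l -addrA lerD2l -mulrDr !ler_pM2l ?h1.
Qed.

Lemma node_nil (R : realType) n (x : R) : node R n [::] x <-> 0 <= x <= 1.
Proof. by rewrite /node /= in_itv /= add0r. Qed.

Lemma node_itv (R : realType) n w (x : R) : node R n w x -> 0 <= x <= 1.
Proof.
elim: w n x => [|c v IH] n x; first by move/node_nil.
move=> /nodeP[y /IH y01 ->].
by apply: zoom_itv => //; [exact: level_ratio_gt0|exact: level_ratio_le].
Qed.

Lemma node_near (R : realType) n w (x y : R) : node R n w x -> node R n w y ->
  `|x - y| <= width R n (size w).
Proof. by rewrite /node /= !in_itv /= ler_norml; lra. Qed.

Lemma corner_node (R : realType) n w : node R n w (corner R n w).
Proof. by rewrite /node /= in_itv /= lexx lerDl ltW ?width_gt0. Qed.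

Lemma node_tower (R : realType) n w (x : R) :
  node R n w x -> node R n (carry w) (tower n x).
Proof.
elim: w n x => [|c v IH] n x; first by move/node_nil/tower_range/node_nil.
move=> /nodeP[y yv ->]; have y01 := node_itv yv.
rewrite zoom_tower //= nodeP; exists (if c.2 then tower n.+1 y else y) => //.
by case: c.2 => //; exact: IH.
Qed.

Lemma node_uniq (R : realType) n w v (x : R) : size w = size v ->
  node R n w x -> node R n v x -> w = v.
Proof.
have r0 := level_ratio_gt0 R; have r1 := level_ratio_le R.
elim: w v n x => [|c w IH] [|d v] n x //= [sz] /nodeP[y yw ->] /nodeP[z zv].
move=> e; have [-> yz] := zoom_inj (r0 n) (r1 n) (node_itv yw) (node_itv zv) e.
by congr (_ :: _); apply: IH sz yw _; rewrite yz.
Qed.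

Lemma node_prefix (R : realType) n w v (x : R) :
  node R n (w ++ v) x -> node R n w x.
Proof.
elim: w n x => [|c w IH] n x /=; first by move/node_itv/node_nil.
by move=> /nodeP[y /IH yw ->]; apply/nodeP; exists y.
Qed.

Lemma node_take (R : realType) n k w (x : R) :
  node R n w x -> node R n (take k w) x.
Proof. by rewrite -[in node _ _ w _](cat_take_drop k w); exact: node_prefix. Qed.

(** * Orbits that do not reach a given depth *)

(** Each of the finitely many steps before the orbit hits [C] has at most
    countably many injective branches to choose from. *)
Lemma countable_pullback (T : Type) (f : T -> T) (G : nat -> set T) (C : set T) :
  (forall i x y, G i x -> G i y -> f x = f y -> x = y) -> countable C ->
  countable [set x | exists m, C (iter m f x) /\
    forall j, (j < m)%N -> exists i, G i (iter j f x)].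
Proof.
move=> Ginj cC.
pose E m := [set x | C (iter m f x) /\
  forall j, (j < m)%N -> exists i, G i (iter j f x)].
have cE m : countable (E m).
  elim: m => [|m IH].
    by apply: sub_countable cC; apply: subset_card_le => x [].
  apply: (@sub_countable _ _ _ (\bigcup_(i in [set: nat]) (G i `&` f @^-1` E m))).
    apply: subset_card_le => x [Cx Gx]; have [i Gi] := Gx 0 isT.
    exists i => //; split=> //; split; first by rewrite -iterSr.
    by move=> j jm; rewrite -iterSr; apply: Gx.
  apply: bigcup_countable => // i _.
  rewrite -(eq_countable (inj_card_eq (f := f) _)); last first.
    by move=> x y /set_mem[Gx _] /set_mem[Gy _]; exact: Ginj Gx Gy.
  by apply: sub_countable IH; apply: subset_card_le => _ [x [_ Ex] <-].
apply: (@sub_countable _ _ _ (\bigcup_(m in [set: nat]) E m)).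
  by apply: subset_card_le => x [m Em]; exists m.
by apply: bigcup_countable => // m _; exact: cE.
Qed.

Lemma bernoulli (R : realType) (s : R) m : 1 <= s -> 1 + m%:R * (s - 1) <= s ^+ m.
Proof.
move=> s1; elim: m => [|m IH]; first by rewrite mul0r addr0 expr0.
rewrite exprS -addn1 natrD mulrDl mul1r.
have m0 : 0 <= m%:R :> R by [].
have : s * (1 + m%:R * (s - 1)) <= s * s ^+ m by rewrite ler_pM2l //; lra.
by apply: le_trans; have := sqr_ge0 (s - 1); rewrite expr2; nra.
Qed.

(** An orbit confined to a bounded set on which the map is affine and expanding
    is the fixed point: its distance to the fixed point grows geometrically. *)
Lemma expanding_trap (R : realType) (f : R -> R) (G : set R) (s c M x : R) :
  1 < `|s| -> (forall y, G y -> f y = s * y + c) -> (forall y, G y -> `|y| <= M) ->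
  (forall m, G (iter m f x)) -> x = c / (1 - s).
Proof.
move=> s1 fG GM Gx; apply/eqP/negPn/negP => xp.
have sN1 : 1 - s != 0.
  apply/eqP => e; have e1 : s = 1 by lra.
  by move: s1; rewrite e1 normr1; lra.
pose p := c / (1 - s); pose d := `|x - p|.
have d0 : 0 < d by rewrite normr_gt0 subr_eq0.
have E m : `|iter m f x - p| = `|s| ^+ m * d.
  elim: m => [|m IH]; first by rewrite expr0 mul1r.
  rewrite /= fG // exprS -mulrA -IH -normrM; congr `| _ |.
  by rewrite /p; field.
have B m : `|s| ^+ m * d <= M + `|p|.
  by rewrite -E (le_trans (ler_normB _ _)) // lerD2r GM.
(* Chosen so that Bernoulli's inequality exceeds the bound [B]. *)
pose m := Num.bound ((M + `|p|) / (d * (`|s| - 1))).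
have q0 : 0 < d * (`|s| - 1) by rewrite mulr_gt0 ?subr_gt0.
have := archi_boundP (_ : 0 <= (M + `|p|) / (d * (`|s| - 1))).
rewrite divr_ge0 ?(ltW q0) //; last first.
  by apply: le_trans (B 0); rewrite expr0 mul1r ltW.
move=> /(_ isT); rewrite -/m ltr_pdivrMr // => h.
have := bernoulli m (ltW s1) => /(ler_wpM2r (ltW d0)) h2.
have := B m; lra.
Qed.

Definition gap (R : realType) (r : R) (i : nat) : set R :=
  match i with
  | 0 => [set x | r < x < 5^-1]
  | 1 => [set x | 5^-1 + r < x < 4 / 5 - r]
  | _ => [set x | 4 / 5 < x < 1 - r]
  end.

Definition gap_slope (R : realType) (r : R) (i : nat) : R :=
  if i is 1 then slope1 r else slope0 r.

Definition gap_icpt (R : realType) (r : R) (i : nat) : R :=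
  match i with
  | 0 => icpt0 r
  | 1 => icpt1 r
  | _ => 1 - slope0 r - icpt0 r
  end.

Section Gaps.
Variables (R : realType) (n : nat).
Local Notation r := (level_ratio R n).

Lemma tower_gapE i (x : R) : gap r i x ->
  tower n x = gap_slope r i * x + gap_icpt r i.
Proof.
case: i => [|[|i]] /= xI.
- by rewrite tower_gap //; lra.
- by rewrite tower_middle //; lra.
- by rewrite -[in LHS](subKr 1 x) tower_sym tower_gap; [ring|lra].
Qed.

Lemma gap_slope_gt1 i : 1 < `|gap_slope r i|.
Proof.
have r0 := level_ratio_gt0 R n; have r1 := level_ratio_le R n.
have s0 := slope0_bound r0 r1; have s1 := slope1_bound r0 r1.
by case: i => [|[|i]] /=; [rewrite ler0_norm|rewrite ger0_norm|rewrite ler0_norm]; lra.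
Qed.

Lemma gap_inj i (x y : R) : gap r i x -> gap r i y -> tower n x = tower n y -> x = y.
Proof.
move=> xi yi; rewrite !(tower_gapE (i := i)) // => /addIr; apply: mulfI.
by rewrite -normr_gt0 (lt_trans ltr01) ?gap_slope_gt1.
Qed.

Lemma gap_norm i (x : R) : gap r i x -> `|x| <= 1.
Proof.
have r0 := level_ratio_gt0 R n; have r1 := level_ratio_le R n.
by case: i => [|[|i]] /= h; rewrite ler_norml; lra.
Qed.

Lemma node1P c (x : R) : node R n [:: c] x <-> offset r c <= x <= offset r c + r.
Proof. by rewrite /node /= /zoom !mulr0 mulr1 !addr0 in_itv. Qed.

Lemma gap_cover (x : R) : 0 <= x <= 1 -> (forall c, ~ node R n [:: c] x) ->
  exists i, gap r i x.
Proof.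
have r0 := level_ratio_gt0 R n; have r1 := level_ratio_le R n.
move=> x01 xN.
have := xN (false, false); have := xN (false, true).
have := xN (true, false); have := xN (true, true).
rewrite !node1P /offset /=.
move=> /negP; rewrite negb_and -!ltNge => /orP h1.
move=> /negP; rewrite negb_and -!ltNge => /orP h2.
move=> /negP; rewrite negb_and -!ltNge => /orP h3.
move=> /negP; rewrite negb_and -!ltNge => /orP h4.
case: (leP x 5^-1) => h; first by exists 0 => /=; lra.
by case: (leP x (4 / 5)) => h'; [exists 1|exists 2] => /=; lra.
Qed.

(** The outer gaps map across themselves and their two neighbouring intervals
    only, so an orbit can leave them only through an interval. *)
Lemma outer_gap_stays i (x : R) : i != 1%N -> gap r i x ->
  (forall c, ~ node R n [:: c] (tower n x)) -> gap r i (tower n x).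
Proof.
have r0 := level_ratio_gt0 R n; have r1 := level_ratio_le R n.
have s0 := slope0_bound r0 r1.
have i0 := icpt0_left r0; have i0' := icpt0_right r0 r1.
move=> i1 xi xN; have := tower_gapE xi.
have x01 : 0 <= x <= 1.
  by case: i i1 xi => [|[|i]] //= _; lra.
have [j] := gap_cover (tower_range n x01) xN.
case: i i1 xi => [|[|i]] //= _ /andP[xl xr]; case: j => [|[|j]] //=.
- by move=> h e; nra.
- by move=> h e; nra.
- by move=> h e; nra.
- by move=> h e; nra.
Qed.

End Gaps.

Lemma iter_tower_itv (R : realType) n m (x : R) :
  0 <= x <= 1 -> 0 <= iter m (tower n) x <= 1.
Proof. by move=> x01; elim: m => //= m; exact: tower_range. Qed.

Lemma iter_node_tower (R : realType) n m w (x : R) :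
  node R n w x -> node R n (iter m carry w) (iter m (tower n) x).
Proof. by move=> xw; elim: m => //= m; exact: node_tower. Qed.

(** The square of the map of level [n] acts inside each of its four intervals
    as the map of level [n.+1]. *)
Lemma iter_zoom_tower (R : realType) n c j (y : R) : 0 <= y <= 1 ->
  iter (2 * j) (tower n) (zoom (level_ratio R n) c y) =
  zoom (level_ratio R n) c (iter j (tower n.+1) y).
Proof.
move=> y01; rewrite iter_double; elim: j => //= j ->.
have yj := iter_tower_itv n.+1 j y01; have yj1 := tower_range n.+1 yj.
by rewrite !zoom_tower //=; case: c => b [].
Qed.

Definition avoiding (R : realType) (n k : nat) : set R :=
  [set x | 0 <= x <= 1 /\
    forall m w, size w = k -> ~ node R n w (iter m (tower n) x)].
Arguments avoiding R n k : clear implicits.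

(** An orbit that avoids depth [k.+1] either avoids depth [1], and then is
    trapped in a gap, hence lands on one of three repelling fixed points, or
    first reaches depth [1] at a point which avoids depth [k] for the map of
    the next level. In both cases it lands in a countable set, and up to then
    it only uses the injective branches over the gaps. *)
Lemma countable_avoiding (R : realType) n k : countable (avoiding R n k).
Proof.
elim: k n => [|k IH] n.
  apply: sub_countable (@countable0 R); apply: subset_card_le => x [x01 /(_ 0 [::])].
  by move=> /(_ erefl); rewrite node_nil.
pose r := level_ratio R n.
pose fix_pt i := gap_icpt r i / (1 - gap_slope r i).
pose C : set R := (\bigcup_(c in [set: bool * bool]) (zoom r c @` avoiding R n.+1 k))
  `|` range fix_pt.
have cC : countable C.
  rewrite /C -bigcup2E; apply: bigcup_countable => // -[|[|i]] _ //=.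
    apply: bigcup_countable => // c _.
    exact: sub_countable (card_image_le _ _) (IH n.+1).
  by apply: sub_countable (card_image_le _ _) _.
have h := countable_pullback (@gap_inj R n) cC.
apply: sub_countable h; apply: subset_card_le => x [x01 xN].
have [[m0 hit0]|nohit] := pselect (exists m c, node R n [:: c] (iter m (tower n) x)).
  have ex : exists m, `[< exists c, node R n [:: c] (iter m (tower n) x) >].
    by exists m0; apply/asboolP.
  case: (ex_minnP ex) => m /asboolP[c] /nodeP[y /node_nil y01 my] mmin.
  exists m; split.
    left; exists c => //; exists y => //; split=> // m' w wk yw.
    apply: (xN (2 * m' + m)%N (c :: w)); first by rewrite /= wk.
    by rewrite iterD my iter_zoom_tower //; apply/nodeP; eexists; [exact: yw|].
  move=> j jm; apply: gap_cover; first exact: iter_tower_itv.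
  move=> d jd; have := mmin j; rewrite leqNgt jm => /(_ _)/negP; apply=> //.
  by apply/asboolP; exists d.
have cov m : exists i, gap r i (iter m (tower n) x).
  apply: gap_cover; first exact: iter_tower_itv.
  by move=> c mc; apply: nohit; exists m, c.
have trap i m : (forall j, gap r i (iter j (tower n) (iter m (tower n) x))) ->
    iter m (tower n) x = fix_pt i.
  by apply: expanding_trap; [exact: gap_slope_gt1|exact: tower_gapE|exact: gap_norm].
have [[m [i [i1 mi]]]|inner] :=
    pselect (exists m i, i != 1%N /\ gap r i (iter m (tower n) x)).
  exists m; split; last by move=> j _; exact: cov.
  right; exists i => //; apply/esym/trap => j.
  elim: j => //= j IHj; apply: outer_gap_stays => // c jc.
  by apply: nohit; exists (j + m).+1, c; rewrite /= iterD.
exists 0; split=> //; right; exists 1%N => //; apply/esym/(trap 1%N 0%N) => j.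
have [i ji] := cov j; have [<- //|i1] := eqVneq i 1%N.
by case: inner; exists j, i.
Qed.

(** * The map and its horseshoe *)

(** The tower at the bottom, a bridge up to the fixed point [2], and the tent of
    slope [3] over the segment from [2] to [3], whose peak exceeds [3]: the points
    that leave this segment do so across the peak, and then fall below [2]. *)
Definition sysmap (R : realType) : R -> R :=
  splice 1 (@tower R 0)
    (splice 2 (fun x => 6 / 5 * x + - (2 / 5))
      (splice (5 / 2) (fun x => 3 * x + - 4) (fun x => - 3 * x + 11))).
Arguments sysmap R x : clear implicits.

Section Map.
Variable R : realType.
Local Notation S := (sysmap R).

Lemma sysmap_tower x : x <= 1 -> S x = tower 0 x.
Proof. by rewrite /sysmap /splice => ->. Qed.

Lemma sysmap_bridge x : 1 <= x <= 2 -> S x = 6 / 5 * x - 2 / 5.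
Proof.
move=> /andP[x1 x2]; rewrite /sysmap /splice x2; case: ifPn => // x1'.
by have -> : x = 1 by [lra]; rewrite tower1; lra.
Qed.

Lemma sysmap_rise x : 2 <= x <= 5 / 2 -> S x = 3 * x - 4.
Proof.
move=> /andP[x1 x2]; rewrite /sysmap /splice x2; case: ifPn => x1'; first by lra.
by case: ifPn => // x2'; lra.
Qed.

Lemma sysmap_fall x : 5 / 2 <= x -> S x = 11 - 3 * x.
Proof.
move=> x1; rewrite /sysmap /splice; case: ifPn => x1'; first by lra.
by case: ifPn => x2'; [lra|case: ifPn => x3'; lra].
Qed.

Lemma sysmap_lip : lip 3 S.
Proof.
have l (s c : R) : -3 <= s <= 3 -> lip 3 (fun x : R => s * x + c).
  by move=> h; apply: lip_affine; rewrite ler_norml.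
apply: lip_splice.
- move=> x y; apply: le_trans (tower_lip 0 x y) _.
  by apply: ler_wpM2r => //; lra.
- apply: lip_splice; [apply: l; lra| |rewrite /splice ifT; lra].
  by apply: lip_splice; [apply: l; lra|apply: l; lra|lra].
- by rewrite /splice ifT ?tower1; lra.
Qed.

Lemma sysmap_continuous : continuous S.
Proof. exact: lip_continuous sysmap_lip. Qed.

Lemma iter_sysmap_continuous m : continuous (iter m S).
Proof.
elim: m => [|m IH] x; first exact: cvg_id.
by apply: (@continuous_comp _ _ _ (iter m S) S); [exact: IH|exact: sysmap_continuous].
Qed.

Lemma sysmap_lip_low x y : x <= 2 -> y <= 2 -> `|S x - S y| <= 9 / 5 * `|x - y|.
Proof.
have E z : z <= 2 -> S z = splice 1 (@tower R 0) (fun x => 6 / 5 * x + - (2 / 5)) z.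
  by move=> z2; rewrite /sysmap /splice z2.
move=> x2 y2; rewrite !E //; apply: lip_splice; first exact: tower_lip.
  by apply: lip_affine; rewrite ger0_norm; lra.
by rewrite tower1; lra.
Qed.

Lemma sysmap_unit x : 0 <= x <= 1 -> 0 <= S x <= 1.
Proof. by move=> /[dup] /andP[_ x1] x01; rewrite sysmap_tower ?tower_range. Qed.

Lemma sysmap_low x : 0 <= x <= 2 -> 0 <= S x <= 2.
Proof.
move=> /andP[x0 x2]; case: (leP x 1) => x1.
  by have := @sysmap_unit x; rewrite x0 x1 => /(_ isT); lra.
by rewrite sysmap_bridge; lra.
Qed.

Lemma sysmap_high x : 2 <= x <= 7 / 2 -> 1 / 2 <= S x <= 7 / 2.
Proof.
move=> /andP[x2 x3]; case: (leP x (5 / 2)) => h.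
  by rewrite sysmap_rise; lra.
by rewrite sysmap_fall; lra.
Qed.

Lemma sysmap_range x : 0 <= x <= 7 / 2 -> 0 <= S x <= 7 / 2.
Proof.
move=> x0; case: (leP x 2) => x2.
  by have := @sysmap_low x; lra.
by have := @sysmap_high x; lra.
Qed.

Lemma iter_sysmap_range m x : 0 <= x <= 7 / 2 -> 0 <= iter m S x <= 7 / 2.
Proof. by move=> xI; elim: m => //= m; exact: sysmap_range. Qed.

Lemma iter_sysmap_tower m x : 0 <= x <= 1 -> iter m S x = iter m (@tower R 0) x.
Proof.
move=> x01; elim: m => //= m ->; apply: sysmap_tower.
by case/andP: (iter_tower_itv 0 m x01).
Qed.

Definition horseshoe : set R := [set x | forall m, 2 <= iter m S x <= 3].
Local Notation K := horseshoe.

Definition inverse_branch (b : bool) (y : R) : R := if b then 3 - (y - 2) / 3 else 2 + (y - 2) / 3.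

Lemma sysmap_inverse_branch b y : 2 <= y <= 3 -> S (inverse_branch b y) = y.
Proof. by case: b => /= h; [rewrite sysmap_fall|rewrite sysmap_rise]; lra. Qed.

Lemma horseshoe_sysmap x : K x -> K (S x).
Proof. by move=> Kx m; rewrite -iterSr; exact: Kx. Qed.

Lemma horseshoe_inverse_branch b y : K y -> K (inverse_branch b y).
Proof.
move=> Ky; have y23 := Ky 0; rewrite /= in y23.
move=> [|m]; last by rewrite iterSr sysmap_inverse_branch.
by rewrite /= /inverse_branch; case: b; lra.
Qed.

Lemma horseshoeE x : K x -> exists b, x = inverse_branch b (S x).
Proof.
move=> Kx; have := Kx 0; have := Kx 1; rewrite /= => S1 x1.
case: (leP x (5 / 2)) => h; [exists false|exists true] => /=.
  by rewrite sysmap_rise; lra.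
by rewrite sysmap_fall; lra.
Qed.

Lemma horseshoe_two : K 2.
Proof.
have S2 : S 2 = 2 by rewrite sysmap_rise; lra.
have it m : iter m S 2 = 2 by elim: m => //= m ->.
by move=> m; rewrite it; lra.
Qed.

Lemma horseshoe_three : K 3.
Proof.
move=> [|m]; first by rewrite /=; lra.
by rewrite iterSr (_ : S 3 = 2) ?sysmap_fall; [exact: horseshoe_two|lra..].
Qed.

Lemma image_horseshoe : S @` K = K.
Proof.
apply/seteqP; split=> [_ [x Kx <-]|y Ky]; first exact: horseshoe_sysmap.
exists (inverse_branch false y); first exact: horseshoe_inverse_branch.
by apply: sysmap_inverse_branch; exact: (Ky 0).
Qed.

Lemma closed_horseshoe : closed K.
Proof.
have -> : K = \bigcap_(m in [set: nat]) (iter m S @^-1` `[2, 3]%classic).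
  apply/seteqP; split=> [x Kx m _|x Kx m]; rewrite /= ?in_itv; first exact: Kx.
  by have := Kx m I; rewrite /= in_itv.
apply: closed_bigI => m _; apply: preimage_closed; last exact: itv_closed.
by move=> x _; exact: iter_sysmap_continuous.
Qed.

Lemma horseshoe_itv : K `<=` `[2, 3]%classic.
Proof. by move=> x /(_ 0); rewrite /= in_itv. Qed.

Lemma compact_horseshoe : compact K.
Proof.
exact: subclosed_compact closed_horseshoe (@segment_compact _ _ _) horseshoe_itv.
Qed.

(** Each inverse branch contracts by [3], so the two end points [2] and [3]
    pull back to points of the horseshoe as near to a given one as desired. *)
Lemma horseshoe_neighbour m x : K x ->
  exists y, [/\ K y, y != x & `|x - y| <= 3^-1 ^+ m].
Proof.
elim: m x => [|m IH] x Kx.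
  have := Kx 0; rewrite /= expr0 => x23; have [->|x2] := eqVneq x 2.
    exists 3; split; [exact: horseshoe_three|lra|by rewrite ler_norml; lra].
  exists 2; split; [exact: horseshoe_two|by rewrite eq_sym|by rewrite ler_norml; lra].
have [b xb] := horseshoeE Kx.
have [y [Ky yx dy]] := IH _ (horseshoe_sysmap Kx).
exists (inverse_branch b y); split; first exact: horseshoe_inverse_branch.
  apply: contraNneq yx => e; have y23 := Ky 0.
  by rewrite -(sysmap_inverse_branch b (y := y)) // e.
rewrite {1}xb exprSr; move: dy; rewrite /inverse_branch !ler_norml.
by case: b {xb}; lra.
Qed.

(** Pulling back by the two inverse branches doubles the number of the covering
    segments and divides their lengths by [3]; the second branch reverses the
    orientation, hence the shift of the left end. *)
Lemma horseshoe_cover m : exists s : seq R, size s = (2 ^ m)%N /\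
  forall x, K x -> exists2 a, a \in s & a <= x <= a + 3^-1 ^+ m.
Proof.
elim: m => [|m [s [sz cov]]].
  exists [:: 2]; split=> // x /(_ 0) /= x23; exists 2; first by rewrite inE.
  by rewrite expr0; lra.
exists ([seq inverse_branch false a | a <- s] ++
  [seq inverse_branch true a - 3^-1 ^+ m.+1 | a <- s]).
split; first by rewrite size_cat !size_map sz addnn -mul2n expnS.
move=> x Kx; have [b xb] := horseshoeE Kx.
have [a sa] := cov _ (horseshoe_sysmap Kx); rewrite !exprSr => h.
case: b xb => xb.
  exists (inverse_branch true a - 3^-1 ^+ m * 3^-1).
    by rewrite mem_cat; apply/orP; right; apply/mapP; exists a.
  by rewrite xb /=; lra.
exists (inverse_branch false a).
  by rewrite mem_cat; apply/orP; left; apply/mapP; exists a.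
by rewrite xb /=; lra.
Qed.

Lemma measure_cover (s : seq R) (e : R) : 0 <= e ->
  (@lebesgue_measure R (\big[setU/set0]_(a <- s) `[a, (a + e)%R]%classic) <=
    ((size s)%:R * e)%:E)%E.
Proof.
move=> e0; elim: s => [|a s IH]; first by rewrite big_nil measure0 mul0r.
have mU : measurable (\big[setU/set0]_(b <- s) `[b, (b + e)%R]%classic).
  by apply: bigsetU_measurable => b _; exact: measurable_itv.
rewrite big_cons; apply: le_trans; first exact: measureU2.
rewrite /= -natr1 mulrDl mul1r addrC EFinD; apply: leeD => //.
rewrite lebesgue_measure_itv /= lte_fin; case: ifPn => _.
  by rewrite -EFinB lee_fin addrC addKr.
by rewrite lee_fin.
Qed.

Lemma measurable_horseshoe : measurable K.
Proof. exact: closed_measurable closed_horseshoe. Qed.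

Lemma measure_horseshoe : (@lebesgue_measure R K = 0)%E.
Proof.
have B m : (@lebesgue_measure R K <= ((2 / 3) ^+ m)%:E)%E.
  have [s [sz cov]] := horseshoe_cover m.
  have e0 : 0 <= 3^-1 ^+ m :> R by rewrite exprn_ge0.
  have -> : ((2 / 3 : R) ^+ m) = (size s)%:R * 3^-1 ^+ m by rewrite sz natrX -exprMn.
  apply: le_trans (measure_cover s e0).
  apply: le_measure; rewrite ?inE; first exact: measurable_horseshoe.
    by apply: bigsetU_measurable => b _; exact: measurable_itv.
  move=> x /cov[a sa ax]; rewrite -bigcup_seq; by exists a; rewrite /= ?in_itv.
apply/eqP; rewrite eq_le; apply/andP; split; last exact: measure_ge0.
apply/lee_addgt0Pr => e e0.
rewrite add0e.
have : ((2 / 3) : R) ^+ m @[m --> \oo] --> (0 : R).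
  by apply: cvg_expr; rewrite ger0_norm; lra.
move=> /cvgrPdist_lt/(_ _ e0)[m _ /(_ m (leqnn m))] /=.
rewrite sub0r normrN ger0_norm => [h|]; last by apply: exprn_ge0; lra.
by apply: le_trans (B m) _; rewrite lee_fin ltW.
Qed.

(** Total disconnectedness holds because a null set contains no segment. *)
Lemma cantor_horseshoe : cantor_set K.
Proof.
split; [by exists 2; exact: horseshoe_two|exact: compact_horseshoe| |].
- split; first exact: closed_horseshoe.
  apply/seteqP; split=> [x|x Kx].
    by move=> lx; apply: closed_horseshoe; exact: subset_limit_point lx.
  move=> U /nbhs_ballP[e e0 xU].
  have : (3^-1 : R) ^+ m @[m --> \oo] --> (0 : R).
    by apply: cvg_expr; rewrite ger0_norm; lra.
  move=> /cvgrPdist_lt/(_ _ e0)[m _ /(_ m (leqnn m))] /=.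
  rewrite sub0r normrN ger0_norm ?exprn_ge0 // => h.
  have [y [Ky yx dy]] := horseshoe_neighbour m Kx.
  exists y; split=> //; apply: xU; rewrite /ball /=; exact: le_lt_trans dy h.
- move=> x Kx; apply/seteqP; split=> [y [A [Ax AK cA] Ay]|_ ->]; last first.
    exact: connected_component_refl.
  apply: contrapT => /= yx.
  have iA : is_interval A by apply/connected_intervalP.
  have seg u v : A u -> A v -> u < v -> False.
    move=> Au Av uv.
    have : (@lebesgue_measure R `[u, v]%classic <= @lebesgue_measure R K)%E.
      apply: le_measure; rewrite ?inE //; first exact: measurable_horseshoe.
      by move=> z; rewrite /= in_itv /= => zuv; apply: AK; exact: iA Au Av z zuv.
    rewrite measure_horseshoe lebesgue_measure_itv /= lte_fin uv.
    by rewrite -EFinB lee_fin subr_le0 leNgt uv.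
  by case: (ltgtP x y) => [xy|xy|xy]; [exact: seg xy|exact: seg xy|exact: yx].
Qed.

End Map.

(** * The attractor *)

Section Attractor.
Variable R : realType.
Local Notation S := (sysmap R).
Local Notation mu := (@lebesgue_measure R).
Local Notation K := (@horseshoe R).
Local Notation I := (`[(0 : R), 7 / 2]%classic).

Definition unreached (k : nat) : set R :=
  [set x | 0 <= x <= 7 / 2 /\ forall m w, size w = k -> ~ node R 0 w (iter m S x)].

Definition high_piece (i : nat) : set R :=
  match i with
  | 0 => [set x | 1 <= x <= 2]
  | 1 => [set x | 2 <= x <= 5 / 2]
  | _ => [set x | 5 / 2 <= x]
  end.

Lemma high_piece_inj i (x y : R) : high_piece i x -> high_piece i y -> S x = S y -> x = y.
Proof.
case: i => [|[|i]] /= hx hy.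
- by rewrite !sysmap_bridge //; lra.
- by rewrite !sysmap_rise //; lra.
- by rewrite !sysmap_fall //; lra.
Qed.

(** Between [1] and [2] orbits are repelled from the fixed point [2] downwards,
    and above [3] they are sent below [2]. *)
Lemma trapped_high x : 0 <= x <= 7 / 2 -> (forall m, 1 < iter m S x) -> K x.
Proof.
move=> xI x1.
have x2 m : 2 <= iter m S x.
  rewrite leNgt; apply/negP => m2.
  have down j : 1 < iter j S (iter m S x) < 2.
    elim: j => [|j IH]; first by rewrite /= x1 m2.
    have := x1 (j.+1 + m)%N; rewrite iterD /= => ->.
    by rewrite sysmap_bridge; lra.
  have := @expanding_trap R S [set y | 1 < y < 2] (6 / 5) (- (2 / 5)) 2 (iter m S x).
  have -> : - (2 / 5) / (1 - 6 / 5) = 2 :> R by field; lra.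
  move=> E; have := m2; rewrite E ?ltxx //; first by rewrite ger0_norm; lra.
    by move=> y /= h; rewrite sysmap_bridge; lra.
  by move=> y /= h; rewrite ger0_norm; lra.
move=> m; rewrite x2 /= leNgt; apply/negP => m3.
by have := x2 m.+1; rewrite /= sysmap_fall; lra.
Qed.

(** Outside the horseshoe only countably many points miss depth [k]: the map is
    injective on each of its three pieces above the unit interval. *)
Lemma negligible_unreached k : mu.-negligible (unreached k).
Proof.
pose C := [set x | exists m, avoiding R 0 k (iter m S x) /\
    forall j, (j < m)%N -> exists i, high_piece i (iter j S x)].
have cC : countable C by exact: countable_pullback high_piece_inj (countable_avoiding R 0 k).
have sub : unreached k `<=` K `|` C; last first.
  apply: negligibleS; first exact: sub.
  apply: negligibleU; first by apply/negligibleP;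
    [exact: measurable_horseshoe|exact: measure_horseshoe].
  apply/negligibleP; last exact: countable_lebesgue_measure0.
  by apply: countable_measurable.
move=> x [xI xN].
have [[m0 m01]|high] := pselect (exists m, iter m S x <= 1); last first.
  by left; apply: trapped_high => // m; rewrite ltNge; apply/negP => h; apply: high; exists m.
right; have ex : exists m, iter m S x <= 1 by exists m0.
case: (ex_minnP ex) => m m1 mmin; exists m; split.
  have z01 : 0 <= iter m S x <= 1 by rewrite m1; case/andP: (iter_sysmap_range m xI) => ->.
  split=> // m' w wk; rewrite -iter_sysmap_tower // -iterD; exact: xN.
move=> j jm; have j1 : 1 < iter j S x.
  by rewrite ltNge; apply/negP => /mmin; rewrite leqNgt jm.
case: (leP (iter j S x) 2) => j2; first by exists 0; rewrite /= ltW.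
by case: (leP (iter j S x) (5 / 2)) => j3; [exists 1|exists 2] => /=; lra.
Qed.

Definition attractor : set R :=
  [set x | forall k, exists2 w, size w = k & node R 0 w x].
Local Notation L := attractor.

(** By periodicity of the carry, the finite union over one period is the union
    of all the intervals that an orbit starting in [node R 0 w] may visit. *)
Definition cycle_of (w : seq (bool * bool)) : set R :=
  \bigcup_(j in [set j | (j < 2 ^ size w)%N]) node R 0 (iter j carry w).

Lemma closed_node n w : closed (node R n w).
Proof. exact: itv_closed. Qed.

Lemma closed_cycle_of w : closed (cycle_of w).
Proof. by apply: closed_bigcup => [|j _]; [exact: finite_II|exact: closed_node]. Qed.

Lemma node_cycle j w x : node R 0 (iter j carry w) x -> cycle_of w x.
Proof. by move=> xw; exists (j %% 2 ^ size w)%N; rewrite /= ?ltn_mod ?expn_gt0 ?iter_carry_mod. Qed.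

Lemma iter_node m w x : node R 0 w x -> node R 0 (iter m carry w) (iter m S x).
Proof. by move=> xw; rewrite iter_sysmap_tower ?(node_itv xw) //; exact: iter_node_tower. Qed.

Lemma iter_node_period m w x : node R 0 w x -> node R 0 w (iter (m * 2 ^ size w) S x).
Proof.
move=> /(iter_node (m * 2 ^ size w)).
by rewrite -iter_carry_mod modnMl.
Qed.

Lemma omega_closed (f : R -> R) (C : set R) m x : closed C ->
  (forall j, (m <= j)%N -> C (iter j f x)) -> omega f x `<=` C.
Proof.
move=> cC Cj y /(_ m Logic.I); rewrite closureE; apply: smallest_sub => //.
by move=> _ [j /= mj <-]; exact: Cj.
Qed.

(** The orbit visits the compact set [C] at arbitrarily late times, and any
    cluster point of these visits will do. *)
Lemma omega_meets (f : R -> R) (C : set R) (u : nat -> nat) x : compact C ->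
  (forall j, (j <= u j)%N) -> (forall j, C (iter (u j) f x)) ->
  omega f x `&` C !=set0.
Proof.
move=> cC ju Cu.
have FF : ProperFilter (iter (u j) f x @[j --> \oo]) by exact: fmap_proper_filter.
have FC : (iter (u j) f x @[j --> \oo]) C by exists 0 => // j _; exact: Cu.
have [y [Cy cy]] := cC _ FF FC.
exists y; split=> // n _ B yB.
have nF : (iter (u j) f x @[j --> \oo]) [set iter m f x | m in [set m | (n <= m)%N]].
  by exists n => // j /= nj; exists (u j) => //=; exact: leq_trans nj (ju j).
exact: cy nF yB.
Qed.

Lemma omega_cycle m w x : node R 0 w (iter m S x) -> omega S x `<=` cycle_of w.
Proof.
move=> xw; apply: (@omega_closed _ _ m); first exact: closed_cycle_of.
move=> j mj.
by rewrite -(subnK mj) iterD; apply: (node_cycle (j := (j - m)%N)); exact: iter_node.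
Qed.

Lemma compact_node n w : compact (node R n w).
Proof. exact: segment_compact. Qed.

(** An orbit that enters an interval of depth [k] returns to it every [2 ^ k]
    steps. *)
Lemma omega_node m w x : node R 0 w (iter m S x) -> omega S x `&` node R 0 w !=set0.
Proof.
move=> xw; apply: (@omega_meets _ _ (fun j => j * 2 ^ size w + m)%N).
- exact: compact_node.
- by move=> j; rewrite (leq_trans _ (leq_addr _ _)) ?leq_pmulr ?expn_gt0.
- by move=> j; rewrite iterD; exact: iter_node_period.
Qed.

Lemma attractor_itv : L `<=` [set x | 0 <= x <= 1].
Proof. by move=> x /(_ 0)[w _ /node_itv]. Qed.

Lemma finite_words k : finite_set [set w : seq (bool * bool) | size w = k].
Proof.
have -> : [set w : seq (bool * bool) | size w = k] = range (@tval k _).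
  by apply/seteqP; split=> [w wk|_ [t _ <-]]; [exists (Tuple (introT eqP wk))|exact: size_tuple].
exact: finite_image.
Qed.

Lemma closed_attractor : closed L.
Proof.
have -> : L = \bigcap_(k in [set: nat])
    \bigcup_(w in [set w : seq (bool * bool) | size w = k]) node R 0 w.
  by apply/seteqP; split=> [x Lx k _|x Lx k]; [have [w] := Lx k|have [w] := Lx k Logic.I]; exists w.
apply: closed_bigI => k _; apply: closed_bigcup => [|w _]; last exact: closed_node.
exact: finite_words.
Qed.

Lemma omega_attractor x : 0 <= x <= 7 / 2 -> (forall k, ~ unreached k x) ->
  omega S x `<=` L.
Proof.
move=> xI xr y xy k.
have [m [w [wk xw]]] : exists m w, size w = k /\ node R 0 w (iter m S x).
  apply: contrapT => h; apply: (xr k); split=> // m w wk xw.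
  by apply: h; exists m, w.
have [j _ yj] := omega_cycle xw xy; exists (iter j carry w) => //.
by rewrite size_iter_carry.
Qed.

Lemma node_in_domain n w : node R n w `<=` I.
Proof. by move=> x /node_itv; rewrite /= in_itv /=; lra. Qed.

(** A closed set which contains almost every limit set meets every interval,
    since an interval has positive measure and contains a limit point of each of
    its points. *)
Lemma milnor_attractor : is_milnor_attractor I S L.
Proof.
split; first split.
- exact: closed_attractor.
- by move=> x /attractor_itv; rewrite /= in_itv /=; lra.
- apply: (@negligibleS _ _ _ mu (\bigcup_k unreached k)); last first.
    by apply: negligible_bigcup => k; exact: negligible_unreached.
  move=> x /= /not_implyP[xI xL]; apply: contrapT => xr; apply: xL.
  apply: omega_attractor; first by move: xI; rewrite in_itv.
  by move=> k xk; apply: xr; exists k.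
move=> A [cA _ aeA] y Ly; apply: cA => B /nbhs_ballP[e e0 yB].
have [k ke] := width0_small e0.
have [w wk yw] := Ly k.
have [x xw xA] : exists2 x, node R 0 w x & omega S x `<=` A.
  apply: contrapT => h.
  have : mu.-negligible (node R 0 w).
    apply: negligibleS aeA => x xw /(_ (node_in_domain xw)) xA.
    by apply: h; exists x.
  move=> [N [mN N0 wN]].
  have : (mu (node R 0 w) <= mu N)%E.
    by apply: le_measure; rewrite ?inE //; exact: measurable_itv.
  rewrite N0 lebesgue_measure_itv /= lte_fin ltrDl width_gt0 -EFinB addrAC subrr add0r.
  by rewrite lee_fin leNgt width_gt0.
have [z [xz zw]] := @omega_node 0 w x xw.
exists z; split; first exact: xA.
by apply: yB; rewrite /ball /=; apply: le_lt_trans (node_near yw zw) _; rewrite wk.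
Qed.

(** A neighbourhood of a point of the attractor contains an interval of some
    depth [k], which [2 ^ k] steps map into itself. The inclusion is strict
    because of the fixed point [2] of the horseshoe. *)
Lemma attractor_nonwandering : L `<` nonwandering I S.
Proof.
split.
  move=> y Ly; split; first by move: (attractor_itv Ly); rewrite /= in_itv /=; lra.
  move=> U /nbhs_ballP[e e0 yU].
  have [k ke] := width0_small e0; have [w wk yw] := Ly k.
  have wU : node R 0 w `<=` U.
    by move=> z zw; apply: yU; rewrite /ball /=; apply: le_lt_trans (node_near yw zw) _; rewrite wk.
  exists (1 * 2 ^ k)%N; first by rewrite mul1n expn_gt0.
  exists (iter (1 * 2 ^ k) S y); split.
    exists y => //; split; first exact: wU.
    exact: node_in_domain yw.
  by apply: wU; rewrite -wk; exact: iter_node_period.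
move=> OL; have : L (2 : R).
  apply: OL; split; first by rewrite /= in_itv /=; lra.
  move=> U U2; exists 1 => //; exists 2; split; last exact: nbhs_singleton.
  exists 2; last by rewrite /= sysmap_rise; lra.
  by split; [exact: nbhs_singleton|rewrite /= in_itv /=; lra].
by move/attractor_itv => /=; lra.
Qed.

End Attractor.

(** * Solenoids with null basins *)

(** A branch of the tree of words: the successive prefixes of an infinite word. *)
Definition coherent (v : nat -> seq (bool * bool)) : Prop :=
  forall k, size (v k) = k /\ v k = take k (v k.+1).

Lemma coherent_take v k j : coherent v -> (k <= j)%N -> take k (v j) = v k.
Proof.
move=> cv; elim: j => [|j IH].
  by rewrite leqn0 => /eqP ->; rewrite take0; case: (cv 0) => /eqP; rewrite size_eq0 => /eqP.
rewrite leq_eqVlt => /orP[/eqP ->|kj]; first by rewrite take_oversize ?(cv j.+1).1.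
by rewrite -IH // (cv j).2 take_takel.
Qed.

Section Solenoids.
Variable R : realType.
Local Notation S := (sysmap R).
Local Notation mu := (@lebesgue_measure R).
Local Notation I := (`[(0 : R), 7 / 2]%classic).
Local Notation L := (@attractor R).

Definition follows (v : nat -> seq (bool * bool)) (x : R) : Prop :=
  forall k, node R 0 (v k) x.

Lemma coherent_point v : coherent v -> exists x, follows v x.
Proof.
move=> cv; pose F : set_system R := corner R 0 (v j) @[j --> \oo].
have FF : ProperFilter F by exact: fmap_proper_filter.
have Fnode k : F (node R 0 (v k)).
  exists k => // j /= kj; rewrite -(coherent_take cv kj); apply: node_take.
  exact: corner_node.
have [x [_ cx]] := compact_node FF (Fnode 0).
exists x => k; apply: (@closed_node _ 0 (v k)) => B xB.
exact: cx (Fnode k) xB.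
Qed.

(** Minimality of the odometer: an orbit which starts in all the intervals of a
    branch visits each interval of each of their cycles infinitely often. *)
Lemma omega_follows v x : coherent v -> follows v x ->
  omega S x = \bigcap_(i in [set: nat]) cycle_of (v i).
Proof.
move=> cv vx; apply/seteqP; split=> [y xy i _|y yv n _ B /nbhs_ballP[e e0 yB]].
  exact: (@omega_cycle R 0 (v i) x (vx i)) _ xy.
have [k ke] := width0_small e0; have [j _ yj] := yv k Logic.I.
have xj : node R 0 (iter j carry (v k)) (iter (j + n * 2 ^ k) S x).
  have := iter_node (j + n * 2 ^ k) (vx k).
  by rewrite iterD -[iter (n * _) _ _]iter_carry_mod (cv k).1 modnMl.
exists (iter (j + n * 2 ^ k) S x); split.
  exists (j + n * 2 ^ k)%N => //=.
  by rewrite (leq_trans _ (leq_addl _ _)) ?leq_pmulr ?expn_gt0.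
apply: yB; rewrite /ball /=; apply: le_lt_trans (node_near yj xj) _.
by rewrite size_iter_carry (cv k).1.
Qed.

Lemma solenoid_follows v x : coherent v -> follows v x -> solenoid I S (omega S x).
Proof.
move=> cv vx; split; first by exists x => //; exact: node_in_domain (vx 0).
have sz i : size (v i) = i := (cv i).1.
exists (fun i => 2 ^ i)%N, (fun i j => corner R 0 (iter j carry (v i))),
  (fun i j => corner R 0 (iter j carry (v i)) + width R 0 i) => J level.
have JE i j : J i j = node R 0 (iter j carry (v i)).
  by rewrite /J /node size_iter_carry sz.
have levelE i : level i = cycle_of (v i).
  rewrite /level /cycle_of sz; apply: eq_bigcupr => j _; exact: JE.
split; [by move=> i; rewrite expn_gt0| | |split].
- move=> i j _; split; first by rewrite ltrDl width_gt0.
  by rewrite JE; exact: node_in_domain.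
- by rewrite (omega_follows cv vx); apply: eq_bigcapr => i _; rewrite levelE.
- by move=> N; exists N; rewrite ltn_expl.
- move=> i; rewrite !levelE => y [j _ yj]; apply: (node_cycle (j := j)).
  by rewrite (cv i).2 -take_iter_carry; exact: node_take.
- move=> i j _ _ [y yJ <-]; rewrite JE; move: yJ; rewrite JE => yJ.
  by have := iter_carry_mod j.+1 (v i); rewrite sz => ->; exact: (iter_node 1 yJ).
- apply/cvgrPdist_lt => e e0.
  have : (8^-1 : R) ^+ k @[k --> \oo] --> (0 : R).
    by apply: cvg_expr; rewrite ger0_norm; lra.
  move=> /cvgrPdist_lt/(_ _ e0); apply: filterS => k.
  rewrite !sub0r !normrN ger0_norm ?exprn_ge0 // => ke.
  rewrite ger0_norm; last by exact: bigmax_ge_id.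
  apply: bigmax_lt => // j _; rewrite addrAC subrr add0r.
  exact: le_lt_trans (width0_le R k) ke.
Qed.

Definition captured (w : seq (bool * bool)) : set R :=
  [set x | I x /\ exists m j, node R 0 (iter j carry w) (iter m S x)].

Lemma measurable_captured w : measurable (captured w).
Proof.
have -> : captured w = \bigcup_m \bigcup_j
    (I `&` iter m S @^-1` node R 0 (iter j carry w)).
  apply/seteqP; split=> [x [xI [m [j xw]]]|x [m _ [j _ [xI xw]]]].
    by exists m => //; exists j.
  by split=> //; exists m, j.
apply: bigcup_measurable => m _; apply: bigcup_measurable => j _.
apply: closed_measurable; apply: closedI; first exact: itv_closed.
by apply: preimage_closed; [move=> x _; exact: iter_sysmap_continuous|exact: closed_node].
Qed.

Lemma captured_rcons w c : captured (rcons w c) `<=` captured w.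
Proof.
move=> x [xI [m [j xw]]]; split=> //; exists m, j.
have <- : take (size w) (rcons w c) = w by rewrite -cats1 take_size_cat.
by rewrite -take_iter_carry; exact: node_take.
Qed.

(** The first components of the letters are invariant under the carry, so an
    orbit cannot enter the cycles of two words which differ there. *)
Lemma captured_disjoint w c d : c.1 != d.1 ->
  captured (rcons w c) `&` captured (rcons w d) = set0.
Proof.
move=> cd; apply/seteqP; split=> // x [[_ [m [j xc]]] [_ [m' [j' xd]]]].
have xc' := iter_node m' xc; have xd' := iter_node m xd.
rewrite -!iterD in xc' xd'; rewrite [(m + m')%N]addnC in xd'.
have /(congr1 (map fst)) : iter (m' + j) carry (rcons w c) = iter (m + j') carry (rcons w d).
  by apply: node_uniq xc' xd'; rewrite !size_iter_carry !size_rcons.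
rewrite !map_fst_iter_carry !map_rcons => /rcons_inj[] e.
by rewrite e eqxx in cd.
Qed.

Definition mass (w : seq (bool * bool)) : R := fine (mu (captured w)).

Lemma captured_le w : (mu (captured w) <= (7 / 2)%:E)%E.
Proof.
have -> : (7 / 2)%:E = mu I.
  by rewrite lebesgue_measure_itv /= lte_fin ifT ?sube0 // -?EFinB ?subr0 //; lra.
by apply: le_measure; rewrite ?inE; [exact: measurable_captured|exact: measurable_itv|move=> x []].
Qed.

Lemma massE w : mu (captured w) = (mass w)%:E.
Proof.
rewrite fineK // ge0_fin_numE; last exact: measure_ge0.
exact: le_lt_trans (captured_le w) (ltry _).
Qed.

(** The cycles of two extensions of [w] capture disjoint parts of what the
    cycle of [w] captures. *)
Lemma mass_half w : exists c, mass (rcons w c) <= mass w / 2.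
Proof.
(* The two letters differ in their first components. *)
pose c := (false, false); pose d := (true, false).
have : mass (rcons w c) + mass (rcons w d) <= mass w.
  rewrite -lee_fin EFinD -!massE -measureU; first last.
  - exact: captured_disjoint.
  - exact: measurable_captured.
  - exact: measurable_captured.
  apply: le_measure; rewrite ?inE; [|exact: measurable_captured|].
    by apply: measurableU; exact: measurable_captured.
  by move=> x [|]; exact: captured_rcons.
by case: (leP (mass (rcons w c)) (mass w / 2)) => h; [exists c|exists d; lra].
Qed.

Definition lighter (w : seq (bool * bool)) : bool * bool := projT1 (cid (mass_half w)).

(** At each step the word is extended by a letter whose cycle captures at most
    half of the mass. *)
Fixpoint greedy (w : seq (bool * bool)) (i : nat) : seq (bool * bool) :=
  if i is i'.+1 then rcons (greedy w i') (lighter (greedy w i')) else w.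

Lemma size_greedy w i : size (greedy w i) = (size w + i)%N.
Proof. by elim: i => [|i IH] /=; rewrite ?addn0 // size_rcons IH addnS. Qed.

Lemma take_greedy w i k : (k <= size w + i)%N ->
  take k (greedy w i.+1) = take k (greedy w i).
Proof. by move=> ki /=; rewrite -cats1 takel_cat // size_greedy. Qed.

Lemma take_greedyD w i j : take (size w + i) (greedy w (i + j)) = greedy w i.
Proof.
elim: j => [|j IH]; first by rewrite addn0 -size_greedy take_size.
by rewrite addnS take_greedy ?IH // leq_add2l leq_addr.
Qed.

Lemma mass_greedy w i : mass (greedy w i) <= 7 / 2 * 2^-1 ^+ i.
Proof.
elim: i => [|i IH]; first by rewrite expr0 mulr1 -lee_fin -massE captured_le.
have := projT2 (cid (mass_half (greedy w i))) => /= h.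
by apply: le_trans h _; rewrite exprSr; lra.
Qed.

(** For [k] at most [size w] this is a prefix of [w] itself. *)
Definition greedy_branch (w : seq (bool * bool)) (k : nat) : seq (bool * bool) :=
  take k (greedy w k).

Lemma coherent_greedy w : coherent (greedy_branch w).
Proof.
move=> k; rewrite /greedy_branch; split.
  by rewrite size_take size_greedy; case: ltnP => //; lia.
by rewrite take_takel // take_greedy // leq_addl.
Qed.

Lemma greedy_branchE w i : greedy_branch w (size w + i) = greedy w i.
Proof. by rewrite /greedy_branch addnC -{1}[(i + _)%N]addnC take_greedyD. Qed.

(** A limit set contained in the solenoid does not force the orbit to enter its
    cycles, but entering any other cycle of the same depth is excluded, and an
    orbit outside of the null set enters one. *)
Lemma basin_captured v x : coherent v -> follows v x ->
  basin I S (omega S x) `<=`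
    (\bigcup_k unreached k) `|` (\bigcap_(k in [set: nat]) captured (v k)).
Proof.
move=> cv vx z [zI zx]; have [zr|zr] := pselect (exists k, unreached k z).
  by left; case: zr => k zk; exists k.
right=> k _; split=> //.
have [m [w [wk zw]]] : exists m w, size w = k /\ node R 0 w (iter m S z).
  apply: contrapT => h; apply: zr; exists k; split; first by move: zI; rewrite /= in_itv.
  by move=> m w wk zw; apply: h; exists m, w.
have [y [zy yw]] := omega_node zw.
have [j _ yj] := @omega_cycle R 0 (v k) x (vx k) y (zx y zy).
exists m, j; rewrite -(_ : w = iter j carry (v k)) //.
by apply: node_uniq yw yj; rewrite size_iter_carry wk (cv k).1.
Qed.

Lemma negligible_greedy_basin w x : follows (greedy_branch w) x ->
  mu.-negligible (basin I S (omega S x)).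
Proof.
move=> vx; apply: negligibleS; first exact: basin_captured (coherent_greedy w) vx.
apply: negligibleU; first by apply: negligible_bigcup => k; exact: negligible_unreached.
have mC : measurable (\bigcap_(k in [set: nat]) captured (greedy_branch w k)).
  by apply: bigcapT_measurable => k; exact: measurable_captured.
apply/negligibleP => //; apply/eqP; rewrite eq_le; apply/andP; split; last exact: measure_ge0.
apply/lee_addgt0Pr => e e0; rewrite add0e.
have e1 : 0 < e / (7 / 2) by rewrite divr_gt0.
have : (2^-1 : R) ^+ k @[k --> \oo] --> (0 : R).
  by apply: cvg_expr; rewrite ger0_norm; lra.
move=> /cvgrPdist_lt/(_ _ e1)[i _ /(_ i (leqnn i))] /=.
rewrite sub0r normrN ger0_norm ?exprn_ge0 // => h.
apply: (@le_trans _ _ (mass (greedy w i))%:E).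
  rewrite -massE; apply: le_measure; rewrite ?inE //; first exact: measurable_captured.
  by move=> z zC; rewrite -greedy_branchE; exact: zC.
rewrite lee_fin; apply: le_trans (mass_greedy w i) _.
by move: h; rewrite ltr_pdivlMr //; lra.
Qed.

Definition null_solenoids : set (set R) :=
  [set omega S x | x in [set x | exists2 w, node R 0 w x & follows (greedy_branch w) x]].

Lemma null_solenoidsP A : null_solenoids A ->
  solenoid I S A /\ mu.-negligible (basin I S A).
Proof.
move=> [x [w xw vx] <-]; split; first exact: solenoid_follows (coherent_greedy w) vx.
exact: negligible_greedy_basin vx.
Qed.

(** Every interval contains a point of a solenoid with null basin: the greedy
    branch may start with any word. *)
Lemma attractor_closure : L = closure (\bigcup_(A in null_solenoids) A).
Proof.
apply/seteqP; split.
  move=> y Ly B /nbhs_ballP[e e0 yB].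
  have [k ke] := width0_small e0; have [w wk yw] := Ly k.
  have [x vx] := coherent_point (coherent_greedy w).
  have xw : node R 0 w x.
    by have := vx (size w); rewrite -[size w]addn0 greedy_branchE.
  have [z [xz zw]] := @omega_node R 0 w x xw.
  exists z; split; first by exists (omega S x) => //; exists x => //; exists w.
  by apply: yB; rewrite /ball /=; apply: le_lt_trans (node_near yw zw) _; rewrite wk.
rewrite closureE; apply: smallest_sub; first exact: closed_attractor.
move=> y [_ [x [w _ vx] <-] xy] k.
have [j _ yj] := @omega_cycle R 0 _ x (vx k) y xy.
exists (iter j carry (greedy_branch w k)) => //.
by rewrite size_iter_carry (coherent_greedy w k).1.
Qed.

End Solenoids.

(** * Entropy and variation *)

(** Bounds of exponential type on the cardinalities of separated sets: the
    constant [M] disappears in the growth rate. *)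
Lemma htop_le_growth (R : realType) (f : R -> R) (A : set R) (B : R) : 1 <= B ->
  (forall e, 0 < e -> exists2 M : R, 1 <= M & forall n (E : {fset R}),
     [set` E] `<=` A -> Defs.separated f n e E -> #|` E|%:R <= M * B ^+ n) ->
  (htop f A <= (ln B)%:E)%E.
Proof.
move=> B1 growth; apply: ge_ereal_sup => _ [e /= e0 <-].
have [M M1 hM] := growth e e0.
have lnM0 : 0 <= ln M by exact: ln_ge0.
have lnB0 : 0 <= ln B by exact: ln_ge0.
have B0 : 0 < B by exact: lt_le_trans B1.
have M0 : 0 < M by exact: lt_le_trans M1.
have lms n : (log_max_separated f A n e <= (ln M + ln B *+ n)%:E)%E.
  apply: ge_ereal_sup => _ [E [EA sE] <-]; rewrite lee_fin.
  have [E0|E0] := leqP #|` E| 0.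
    rewrite ln0; first by rewrite addr_ge0 // mulrn_wge0.
    by move: E0; rewrite leqn0 => /eqP ->.
  have Bn : 0 < B ^+ n by rewrite exprn_gt0.
  rewrite -lnXn // -lnM ?posrE // ler_ln ?posrE ?mulr_gt0 ?ltr0n //.
  exact: hM.
apply/lee_addgt0Pr => d d0.
(* From [N] on, the contribution [ln M / n] of the constant is less than [d]. *)
pose N := (Num.bound (ln M / d)).+1.
pose u n := (((n%:R : R)^-1)%:E * log_max_separated f A n e)%E.
apply: (@le_trans _ _ (ereal_sup (u @` [set n | (N <= n)%N]))).
  by apply: ereal_inf_lbound; exists [set n | (N <= n)%N] => //; exists N.
apply: ge_ereal_sup => _ [n /= Nn <-].
have n0 : (0 < n)%N by exact: leq_trans Nn.
have nR : 0 < (n%:R : R) by rewrite ltr0n.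
have nI : 0 <= (n%:R : R)^-1 by rewrite invr_ge0 ltW.
apply: (@le_trans _ _ ((n%:R : R)^-1%:E * (ln M + ln B *+ n)%:E)%E).
  by apply: lee_wpmul2l; [rewrite lee_fin|exact: lms].
rewrite -EFinM -EFinD lee_fin mulrDr -[ln B *+ n]mulr_natl mulrA mulVf ?gt_eqF //.
rewrite mul1r addrC lerD2l mulrC ler_pdivrMr // mulrC -ler_pdivrMr //.
have := archi_boundP (divr_ge0 lnM0 (ltW d0)) => /ltW /le_trans; apply.
by rewrite ler_nat; apply: leq_trans Nn.
Qed.

Lemma htop_ge_growth (R : realType) (f : R -> R) (A : set R) (B e : R) : 0 < B -> 0 < e ->
  (forall n, exists E : {fset R},
     [/\ [set` E] `<=` A, Defs.separated f n e E & B ^+ n <= #|` E|%:R]) ->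
  ((ln B)%:E <= htop f A)%E.
Proof.
move=> B0 e0 growth.
pose u n := (((n%:R : R)^-1)%:E * log_max_separated f A n e)%E.
apply: (@le_trans _ _ (limn_esup u)); last by apply: ereal_sup_ubound; exists e.
apply: le_ereal_inf_tmp => _ [V [N _ NV] <-].
apply: (@le_trans _ _ (u N.+1)); last first.
  by apply: ereal_sup_ubound; exists N.+1 => //; apply: NV => /=.
have [E [EA sE BE]] := growth N.+1.
have nR : 0 < (N.+1%:R : R) by rewrite ltr0n.
have Bn : 0 < B ^+ N.+1 by rewrite exprn_gt0.
apply: (@le_trans _ _ ((N.+1%:R : R)^-1%:E * (ln #|` E|%:R)%:E)%E).
  rewrite -EFinM lee_fin ler_pdivlMl // mulr_natl -lnXn //.
  by rewrite ler_ln ?posrE // (lt_le_trans Bn).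
apply: lee_wpmul2l; first by rewrite lee_fin invr_ge0 ltW.
by apply: ereal_sup_ubound; exists E.
Qed.

Lemma htop_subset (R : realType) (f : R -> R) (A B : set R) : A `<=` B ->
  (htop f A <= htop f B)%E.
Proof.
move=> AB; apply: ge_ereal_sup => _ [e /= e0 <-].
apply: le_trans (ereal_sup_ubound _); last by exists e.
apply: le_ereal_inf_tmp => _ [V FV <-].
pose u n := (((n%:R : R)^-1)%:E * log_max_separated f A n e)%E.
apply: (@le_trans _ _ (ereal_sup (u @` V))).
  by apply: ereal_inf_lbound; exists V.
apply: ge_ereal_sup => _ [n Vn <-].
apply: le_trans (ereal_sup_ubound _); last by exists n.
apply: lee_wpmul2l; first by rewrite lee_fin invr_ge0.
apply: ge_ereal_sup => _ [E [EA sE] <-]; apply: ereal_sup_ubound; exists E => //.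
by split=> //; exact: subset_trans AB.
Qed.

Lemma card_fset_le (K : choiceType) (T : finType) (g : K -> T) (E : {fset K}) :
  {in E &, injective g} -> (#|` E| <= #|T|)%N.
Proof.
move=> gi; rewrite -(size_map g).
have : uniq (map g (enum_fset E)) by rewrite map_inj_in_uniq ?fset_uniq.
by move=> /card_uniqP <-; exact: max_card.
Qed.

Section VariesLe.
Variable R : realType.
Implicit Types (f g : R -> R) (a b c d M : R).

(** The variation of [f] over the segment from [a] to [b] is at most [M]: the
    function [v] dominates the variation of [f] from [a]. *)
Definition varies_le f a b M : Prop := exists2 v : R -> R,
  forall x y, a <= x -> x <= y -> y <= b -> `|f y - f x| <= v y - v x &
  v b - v a <= M.

Lemma varies_le_concat f a b c M N : a <= b -> b <= c ->
  varies_le f a b M -> varies_le f b c N -> varies_le f a c (M + N).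
Proof.
move=> ab bc [v hv vM] [w hw wN].
exists (fun x => if x <= b then v x else v b + (w x - w b)).
  move=> x y ax xy yc; case: ifPn => yb; case: ifPn => xb.
  - exact: hv.
  - by have := le_trans xy yb; rewrite (negbTE xb).
  - rewrite -ltNge in yb; have h1 := hv x b ax xb (lexx b).
    have h2 := hw b y (lexx b) (ltW yb) yc.
    by apply: le_trans (ler_distD (f b) _ _) _; lra.
  - rewrite -!ltNge in xb yb; have := hw x y (ltW xb) xy yc; lra.
rewrite ab; case: ifPn => cb; last by lra.
have -> : c = b by apply/eqP; rewrite eq_le cb.
have := hw b c (lexx b) bc (lexx c); have := normr_ge0 (f c - f b); lra.
Qed.

Lemma varies_le_incr f g a b c d M : a <= b ->
  (forall x y, a <= x -> x <= y -> y <= b -> [/\ c <= g x, g x <= g y & g y <= d]) ->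
  varies_le f c d M -> varies_le (f \o g) a b M.
Proof.
move=> ab hg [v hv vM]; exists (v \o g) => /=.
  by move=> x y ax xy yb; have [h1 h2 h3] := hg x y ax xy yb; exact: hv.
have [h1 h2 h3] := hg a b (lexx a) ab (lexx b).
have := hv c (g a) (lexx c) h1 (le_trans h2 h3).
have := hv (g b) d (le_trans h1 h2) h3 (lexx d).
have := normr_ge0 (f d - f (g b)); have := normr_ge0 (f (g a) - f c); lra.
Qed.

Lemma varies_le_decr f g a b c d M : a <= b ->
  (forall x y, a <= x -> x <= y -> y <= b -> [/\ c <= g y, g y <= g x & g x <= d]) ->
  varies_le f c d M -> varies_le (f \o g) a b M.
Proof.
move=> ab hg [v hv vM]; exists (fun x => - v (g x)) => /=.
  move=> x y ax xy yb; have [h1 h2 h3] := hg x y ax xy yb.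
  by have := hv _ _ h1 h2 h3; rewrite distrC; lra.
have [h1 h2 h3] := hg a b (lexx a) ab (lexx b).
have := hv c (g b) (lexx c) h1 (le_trans h2 h3).
have := hv (g a) d (le_trans h1 h2) h3 (lexx d).
have := normr_ge0 (f d - f (g a)); have := normr_ge0 (f (g b) - f c); lra.
Qed.

Lemma varies_le_lip f a b k :
  (forall x y, a <= x -> x <= y -> y <= b -> `|f y - f x| <= k * (y - x)) ->
  varies_le f a b (k * (b - a)).
Proof.
move=> hf; exists (fun x => k * x); last by lra.
by move=> x y ax xy yb; rewrite -mulrBr; exact: hf.
Qed.

Lemma varies_le_ext f g a b M : f =1 g -> varies_le f a b M -> varies_le g a b M.
Proof.
by move=> fg [v hv vM]; exists v => // x y ax xy yb; rewrite -!fg; exact: hv.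
Qed.

Lemma varies_le_weaken f a b M N : M <= N -> varies_le f a b M -> varies_le f a b N.
Proof. by move=> MN [v hv vM]; exists v => //; exact: le_trans MN. Qed.

(** The functions that dominate the variations of the iterates add up to a
    monotone function, which increases by more than [e] between any two points
    of a separated set. *)
Lemma card_separated_le f a b (M : nat -> R) n e (E : {fset R}) :
  a <= b -> 0 < e -> (forall k, varies_le (iter k f) a b (M k)) ->
  [set` E] `<=` `[a, b]%classic -> Defs.separated f n e E ->
  #|` E|%:R <= (\sum_(k < n) M k) / e + 1.
Proof.
move=> ab e0 var EI sE.
have [v hv] : exists v : nat -> R -> R, forall k,
    (forall x y, a <= x -> x <= y -> y <= b -> `|iter k f y - iter k f x| <= v k y - v k x) /\
    v k b - v k a <= M k.
  have /choice[v hv] : forall k, exists w : R -> R,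
    (forall x y, a <= x -> x <= y -> y <= b -> `|iter k f y - iter k f x| <= w y - w x) /\
    w b - w a <= M k by move=> k; have [w h1 h2] := var k; exists w.
  by exists v.
pose V x := \sum_(k < n) v k x.
have Vmono x y : a <= x -> x <= y -> y <= b -> V x <= V y.
  move=> ax xy yb; apply: ler_sum => k _; rewrite -subr_ge0.
  exact: le_trans (normr_ge0 _) ((hv k).1 x y ax xy yb).
have Vsep x y : a <= x -> x <= y -> y <= b ->
    (exists2 k, (k < n)%N & e < `|iter k f x - iter k f y|) -> V x + e < V y.
  move=> ax xy yb [k kn ek].
  rewrite /V (bigD1 (Ordinal kn)) //= [X in _ < X](bigD1 (Ordinal kn)) //=.
  have := (hv k).1 x y ax xy yb; rewrite distrC => h1.
  have : \sum_(i < n | i != Ordinal kn) v i x <= \sum_(i < n | i != Ordinal kn) v i y.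
    apply: ler_sum => i _; rewrite -subr_ge0.
    exact: le_trans (normr_ge0 _) ((hv i).1 x y ax xy yb).
  by lra.
have Vab : V b - V a <= \sum_(k < n) M k.
  by rewrite /V -sumrB; apply: ler_sum => k _; exact: (hv k).2.
have inI x : x \in E -> a <= x <= b by move=> /EI; rewrite /= in_itv.
pose h x := (V x - V a) / e.
have h0 x : a <= x <= b -> 0 <= h x.
  by move=> /andP[ax xb]; rewrite divr_ge0 ?(ltW e0) // subr_ge0; exact: Vmono.
pose N := Num.truncn (h b).
have hN x : a <= x <= b -> (Num.truncn (h x) < N.+1)%N.
  move=> /andP[ax xb]; rewrite ltnS; apply: le_truncn.
  by rewrite ler_pM2r ?invr_gt0 // lerD2r; exact: Vmono.
have sep x y : x \in E -> y \in E -> x < y -> Num.truncn (h x) <> Num.truncn (h y).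
  move=> xE yE xy exy.
  have /andP[ax xb] := inI x xE; have /andP[ay yb] := inI y yE.
  have /Vsep : exists2 k, (k < n)%N & e < `|iter k f x - iter k f y|.
    by apply: sE; rewrite // lt_eqF.
  move=> /(_ ax (ltW xy) yb) Vxy.
  have hxy : h x + 1 < h y.
    rewrite /h ltr_pdivlMr // mulrDl divfK ?gt_eqF //; lra.
  have /andP[_] := truncn_itv (h0 y (inI y yE)).
  have /andP[+ _] := truncn_itv (h0 x (inI x xE)).
  by rewrite exy -natr1; lra.
have : (#|` E| <= #|'I_N.+1|)%N.
  apply: (card_fset_le (g := fun x => inord (Num.truncn (h x)))) => x y xE yE.
  move=> /(congr1 val) /=; rewrite !inordK ?hN ?inI // => exy.
  case: (ltgtP x y) => // xy; first by case: (sep x y xE yE xy).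
  by case: (sep y x yE xE xy).
rewrite card_ord -(ler_nat R) => /le_trans; apply.
rewrite -natr1 lerD2r; apply: (@le_trans _ _ (h b)).
  by rewrite truncn_le h0 // ab lexx.
by rewrite ler_pM2r ?invr_gt0.
Qed.

End VariesLe.

(** * Entropy of the map *)

Section Entropy.
Variable R : realType.
Local Notation S := (sysmap R).
Local Notation I := (`[(0 : R), 7 / 2]%classic).
Local Notation L := (@attractor R).
Local Notation K := (@horseshoe R).

Lemma iter_sysmap_low k x y : 0 <= x <= 2 -> 0 <= y <= 2 ->
  `|iter k S x - iter k S y| <= (9 / 5) ^+ k * `|x - y|.
Proof.
move=> x02 y02.
have low j z : 0 <= z <= 2 -> 0 <= iter j S z <= 2.
  by move=> z02; elim: j => //= j; exact: sysmap_low.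
elim: k => [|k IH]; first by rewrite expr0 mul1r.
have /andP[_ xk] := low k x x02; have /andP[_ yk] := low k y y02.
rewrite /= exprS -mulrA; apply: le_trans (sysmap_lip_low xk yk) _.
by rewrite ler_pM2l //; lra.
Qed.

Lemma varies_low k : varies_le (iter k S) 0 2 (2 * (9 / 5) ^+ k).
Proof.
apply: (@varies_le_weaken _ _ _ _ ((9 / 5) ^+ k * (2 - 0))); first by lra.
apply: varies_le_lip => x y x0 xy y2.
by rewrite -[y - x]ger0_norm ?subr_ge0 //; apply: iter_sysmap_low; lra.
Qed.

(** The segment above [2] is folded twice over itself and once into the low
    part, where the variation grows at the slower rate [9 / 5]. The negative
    term absorbs this contribution: [10] is [2 / (2 - 9 / 5)]. *)
Lemma varies_high k :
  varies_le (iter k S) 2 (7 / 2) (12 * 2 ^+ k - 10 * (9 / 5) ^+ k).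
Proof.
elim: k => [|k IH].
  apply: (@varies_le_weaken _ _ _ _ (1 * (7 / 2 - 2))); first by rewrite !expr0; lra.
  by apply: varies_le_lip => x y _ xy _ /=; rewrite mul1r ger0_norm // subr_ge0.
apply: (@varies_le_ext _ (iter k S \o S)); first by move=> x; rewrite iterSr.
pose M := 12 * 2 ^+ k - 10 * (9 / 5) ^+ k : R.
apply: (@varies_le_weaken _ _ _ _ (M + (M + 2 * (9 / 5) ^+ k))).
  by rewrite /M !exprS; lra.
apply: (@varies_le_concat _ _ _ (5 / 2)); [lra|lra| |].
  apply: varies_le_incr IH; first by lra.
  by move=> x y x0 xy y0; rewrite !sysmap_rise; [split|..]; lra.
apply: (@varies_le_concat _ _ _ 3); [lra|lra| |].
  apply: varies_le_decr IH; first by lra.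
  by move=> x y x0 xy y0; rewrite !sysmap_fall; [split|..]; lra.
apply: varies_le_decr (varies_low k); first by lra.
by move=> x y x0 xy y0; rewrite !sysmap_fall; [split|..]; lra.
Qed.

Lemma varies_sysmap k : varies_le (iter k S) 0 (7 / 2) (12 * 2 ^+ k).
Proof.
have h : 0 <= (9 / 5) ^+ k :> R by apply: exprn_ge0; lra.
apply: (@varies_le_weaken _ _ _ _
  (2 * (9 / 5) ^+ k + (12 * 2 ^+ k - 10 * (9 / 5) ^+ k))); first by lra.
by apply: varies_le_concat (varies_low k) (varies_high k); lra.
Qed.

Lemma htop_sysmap_le : (htop S I <= (ln (2 : R))%:E)%E.
Proof.
apply: htop_le_growth => [|e e0]; first by lra.
exists (12 / e + 1); first by rewrite lerDr divr_ge0 // ltW.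
move=> n E EI sE.
apply: (le_trans (card_separated_le _ e0 varies_sysmap EI sE)); first by lra.
have -> : \sum_(k < n) 12 * 2 ^+ k = 12 * (2 ^+ n - 1) :> R.
  rewrite -mulr_sumr; congr (_ * _); elim: n {E EI sE} => [|n IH].
    by rewrite big_ord0 expr0 subrr.
  by rewrite big_ord_recr /= IH exprS; lra.
have n1 : 1 <= 2 ^+ n :> R by apply: exprn_ege1; lra.
have e1 : 0 <= e^-1 by rewrite invr_ge0 ltW.
by lra.
Qed.

(** The inverse branches have disjoint images at distance [1/3], so prefixing
    either of them doubles a separated set. *)
Lemma horseshoe_words n : exists s : seq R, [/\ uniq s, size s = (2 ^ n)%N,
  forall x, x \in s -> K x &
  forall x y, x \in s -> y \in s -> x != y ->
    exists2 k, (k < n)%N & 4^-1 < `|iter k S x - iter k S y|].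
Proof.
elim: n => [|n [s [us sz sK sep]]].
  exists [:: 2]; split=> // [x|x y]; first by rewrite inE => /eqP ->; exact: horseshoe_two.
  by rewrite !inE => /eqP -> /eqP ->; rewrite eqxx.
have s23 x : x \in s -> 2 <= x <= 3 by move=> /sK /(_ 0).
have inj b : {in s &, injective (@inverse_branch R b)}.
  by move=> x y xs ys; rewrite /inverse_branch; case: b; lra.
have ub b : uniq [seq inverse_branch b i | i <- s].
  by rewrite map_inj_in_uniq //; exact: inj.
have far x y : x \in s -> y \in s -> 4^-1 < inverse_branch true x - inverse_branch false y.
  by move=> /s23 hx /s23 hy; rewrite /inverse_branch; lra.
have mem z : z \in [seq inverse_branch false i | i <- s] ++ [seq inverse_branch true i | i <- s] ->
    exists b x, x \in s /\ z = inverse_branch b x.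
  by rewrite mem_cat => /orP[|] /mapP[x xs ->]; [exists false, x|exists true, x].
exists ([seq inverse_branch false i | i <- s] ++ [seq inverse_branch true i | i <- s]); split.
- rewrite cat_uniq !ub andbT /=.
  apply/hasPn => z /mapP[x xs ->]; apply/mapP => -[y ys e].
  by have := far x y xs ys; rewrite /inverse_branch; lra.
- by rewrite size_cat !size_map sz addnn -mul2n expnS.
- by move=> z /mem[b [x [xs ->]]]; apply: horseshoe_inverse_branch; exact: sK.
- move=> z t /mem[b [x [xs ->]]] /mem[b' [y [ys ->]]] xy.
  have [bb|bb] := eqVneq b b'; last first.
    exists 0 => //=; case: b b' bb xy => -[] //= _ _.
      exact: lt_le_trans (far x y xs ys) (ler_norm _).
    by rewrite distrC; exact: lt_le_trans (far y x ys xs) (ler_norm _).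
  have xy' : x != y by apply: contraNneq xy => ->; rewrite bb.
  have [k kn hk] := sep x y xs ys xy'; exists k.+1 => //.
  by rewrite !iterSr !sysmap_inverse_branch ?s23.
Qed.

Lemma htop_horseshoe_ge : ((ln (2 : R))%:E <= htop S K)%E.
Proof.
apply: (@htop_ge_growth _ _ _ _ 4^-1); [lra|lra|move=> n].
have [s [us sz sK sep]] := horseshoe_words n.
exists [fset x in s]%fset; split.
- by move=> x; rewrite /= inE => /sK.
- by move=> x y; rewrite !inE; exact: sep.
- by rewrite card_fseq undup_id // sz natrX.
Qed.

Lemma htop_horseshoe : htop S K = (ln (2 : R))%:E /\ htop S I = (ln (2 : R))%:E.
Proof.
have KI : (htop S K <= htop S I)%E.
  apply: htop_subset => x /horseshoe_itv; rewrite /= !in_itv /=; lra.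
split; apply/eqP; rewrite eq_le.
  by rewrite htop_horseshoe_ge (le_trans KI htop_sysmap_le).
by rewrite htop_sysmap_le (le_trans htop_horseshoe_ge KI).
Qed.

(** Two points of the attractor in a common interval stay in common intervals
    of the same small size, so the number of separated points is bounded. *)
Lemma htop_attractor : htop S L = 0%E.
Proof.
apply/eqP; rewrite eq_le; apply/andP; split.
  rewrite -[0%E]/((0 : R)%:E) -(@ln1 R); apply: htop_le_growth => // e e0.
  have [k ke] := width0_small e0.
  have /choice[W hW] : forall x, exists w : k.-tuple (bool * bool), L x -> node R 0 w x.
    move=> x.
    have [Lx|Lx] := pselect (L x); last by exists [tuple of nseq k (false, false)].
    by have [w wk xw] := Lx k; exists (Tuple (introT eqP wk)).
  exists (#|{: k.-tuple (bool * bool)}|%:R).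
    by rewrite ler1n; apply/card_gt0P; exists [tuple of nseq k (false, false)].
  move=> n E EL sE; rewrite expr1n mulr1 ler_nat.
  apply: (card_fset_le (g := W)) => x y xE yE xy; apply/eqP/negPn/negP => xNy.
  have [j _] := sE x y xE yE xNy; apply/negP; rewrite -leNgt.
  have xj := iter_node j (hW x (EL _ xE)); have yj := iter_node j (hW y (EL _ yE)).
  rewrite -xy in yj; apply: le_trans (node_near xj yj) _.
  by rewrite size_iter_carry size_tuple ltW.
rewrite -[0%E]/((0 : R)%:E) -(@ln1 R); apply: (@htop_ge_growth _ _ _ _ 1) => // n.
have [x vx] := coherent_point R (coherent_greedy R [::]).
exists [fset x]%fset; split.
- move=> y; rewrite /= inE => /eqP -> k; exists (greedy_branch R [::] k) => //.
  exact: (coherent_greedy R [::] k).1.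
- by move=> y z; rewrite !inE => /eqP -> /eqP ->; rewrite eqxx.
- by rewrite expr1n cardfs1.
Qed.

End Entropy.

(** * Dimension of the attractor *)

Section Hausdorff.
Variable R : realType.
Local Notation L := (@attractor R).

Lemma diam_ge0 (U : set R) : (0 <= diam U)%E.
Proof. by apply: ereal_sup_ubound; left. Qed.

Lemma diam_set0 : diam (set0 : set R) = 0%E.
Proof.
apply/eqP; rewrite eq_le diam_ge0 andbT; apply: ge_ereal_sup => x [->//|].
by case=> p [].
Qed.

Lemma diam_node w : (diam (node R 0 w) <= (width R 0 (size w))%:E)%E.
Proof.
apply: ge_ereal_sup => _ [->|[[x y] [/= xw yw] <-]]; rewrite lee_fin.
  exact: ltW (width_gt0 _ _ _).
exact: node_near xw yw.
Qed.

(** The lengths decrease so fast that their [s]-th powers outweigh the [4 ^ k]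
    intervals of depth [k] as soon as [1 <= k.+1 * s]. *)
Lemma width_powR (s : R) k : 1 <= k.+1%:R * s ->
  4 ^+ k * (width R 0 k `^ s) <= 2^-1 ^+ k.
Proof.
move=> ks; rewrite widthE muln0 expr0 mul1r exprM.
have x0 : 0 < 8^-1 ^+ k :> R by rewrite exprn_gt0.
have x1 : 8^-1 ^+ k <= 1 :> R by apply: exprn_ile1; lra.
rewrite -(powR_mulrn k.+1 (ltW x0)) -powRrM.
apply: (@le_trans _ _ (4 ^+ k * (8^-1 ^+ k))).
  by rewrite ler_pM2l ?exprn_gt0 // ge1r_powR // x0.
rewrite -exprMn (_ : 4 * 8^-1 = 2^-1 :> R) //; lra.
Qed.

Lemma hausdorff_premeasure_attractor (s d e : R) : 0 < s -> 0 < d -> 0 < e ->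
  (hausdorff_premeasure s d L <= e%:E)%E.
Proof.
move=> s0 d0 e0.
have m0 : 0 < Num.min d e by rewrite lt_min d0.
have : (2^-1 : R) ^+ k @[k --> \oo] --> (0 : R).
  by apply: cvg_expr; rewrite ger0_norm; lra.
move=> /cvgrPdist_lt/(_ _ m0)[N _ Nk].
(* The first bound makes the intervals short and the total small, the second
   one makes [width_powR] applicable. *)
pose k := maxn N (Num.bound s^-1).
have := Nk k (leq_maxl _ _); rewrite /= sub0r normrN ger0_norm ?exprn_ge0 //.
rewrite lt_min => /andP[kd ke].
have ks : 1 <= k.+1%:R * s.
  rewrite -ler_pdivrMr // div1r.
  have := archi_boundP (_ : 0 <= s^-1); rewrite invr_ge0 => /(_ (ltW s0)) /ltW.
  move=> /le_trans; apply; rewrite ler_nat.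
  by apply: leq_trans (leqnSn _); exact: leq_maxr.
have wd : width R 0 k <= d.
  apply: le_trans (width0_le R k) (le_trans _ (ltW kd)).
  by apply: lerXn2r; rewrite ?nnegrE //; lra.
pose ws := [seq val t | t <- enum {: k.-tuple (bool * bool)}].
have szws : size ws = (4 ^ k)%N.
  by rewrite size_map -cardE card_tuple card_prod card_bool.
pose U i := if (i < 4 ^ k)%N then node R 0 (nth [::] ws i) else set0.
have szw i : (i < 4 ^ k)%N -> size (nth [::] ws i) = k.
  rewrite -szws => iw; have /mapP[t _ ->] := mem_nth [::] iw.
  exact: size_tuple.
have dU i : (diam (U i) <= (width R 0 k)%:E)%E.
  rewrite /U; case: ifPn => ik; last by rewrite diam_set0 lee_fin ltW ?width_gt0.
  by apply: le_trans (diam_node _) _; rewrite szw.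
have cov : L `<=` \bigcup_i U i.
  move=> x Lx; have [w wk xw] := Lx k.
  have wws : w \in ws by apply/mapP; exists (Tuple (introT eqP wk)); rewrite ?mem_enum.
  exists (index w ws) => //; rewrite /U -szws index_mem wws nth_index //.
apply: (@le_trans _ _ (\sum_(0 <= i <oo) (diam (U i) `^ s))%E).
  apply: ereal_inf_lbound; exists U => //; split=> // i.
  by apply: le_trans (dU i) _; rewrite lee_fin.
have F0 i : (0 <= diam (U i) `^ s)%E by exact: poweR_ge0.
apply: lime_le; first by apply: is_cvg_nneseries => i _ _; exact: F0.
apply: nearW => n.
pose c := width R 0 k `^ s.
have c0 : 0 <= c by exact: powR_ge0.
apply: (@le_trans _ _ ((minn n (4 ^ k))%:R * c)%:E).
  elim: n => [|n IH]; first by rewrite big_geq // min0n mul0r.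
  rewrite big_nat_recr //=; case: (ltnP n (4 ^ k)) => nk.
    have -> : minn n.+1 (4 ^ k) = (minn n (4 ^ k)).+1 by lia.
    rewrite -natr1 mulrDl mul1r EFinD; apply: leeD => //.
    rewrite -poweR_EFin; apply: gt0_ler_poweR; rewrite ?in_itv /= ?diam_ge0 ?leey //.
      exact: ltW.
    by rewrite lee_fin ltW // width_gt0.
  have -> : minn n.+1 (4 ^ k) = minn n (4 ^ k) by lia.
  by rewrite /U ltnNge nk /= diam_set0 poweR0r ?adde0 // gt_eqF.
rewrite lee_fin; apply: le_trans (ltW ke); apply: le_trans (width_powR ks).
apply: ler_wpM2r => //; rewrite -natrX ler_nat; exact: geq_minr.
Qed.

Lemma hausdorff_premeasure_ge0 (s d : R) (A : set R) : (0 <= hausdorff_premeasure s d A)%E.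
Proof.
apply: le_ereal_inf_tmp => _ [U _ <-]; apply: nneseries_ge0 => i _ _.
exact: poweR_ge0.
Qed.

Lemma hausdorff_measure_attractor (s : R) : 0 < s -> hausdorff_measure s L = 0%E.
Proof.
move=> s0; apply/eqP; rewrite eq_le; apply/andP; split.
  apply: ge_ereal_sup => _ [d /= d0 <-]; apply/lee_addgt0Pr => e e0.
  by rewrite add0e; exact: hausdorff_premeasure_attractor.
apply: le_trans (hausdorff_premeasure_ge0 s 1 L) _.
by apply: ereal_sup_ubound; exists 1; rewrite /= ?ltr01.
Qed.

Lemma hausdorff_dim_attractor : hausdorff_dim L = 0%E.
Proof.
apply/eqP; rewrite eq_le; apply/andP; split.
  apply/lee_addgt0Pr => e e0; rewrite add0e; apply: ereal_inf_lbound.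
  by exists e => //; split=> //; exact: hausdorff_measure_attractor.
by apply: le_ereal_inf_tmp => _ [s [s0 _] <-]; rewrite lee_fin ltW.
Qed.

End Hausdorff.

(** * The theorem *)

Theorem theorem4p2 (R : realType) :
  exists (a b : R) (S : R -> R) (K L : set R),
    let I := `[a, b]%classic in
    [/\ a < b,
        interval_map I S,
        (cantor_set K /\ K `<=` I) /\ S @` K = K &
        is_milnor_attractor I S L] /\
    [/\ (exists F : set (set R),
           (forall A, F A ->
              solenoid I S A /\ (@lebesgue_measure R).-negligible (basin I S A)) /\
           L = closure (\bigcup_(A in F) A)),
        htop S L = 0%E,
        [/\ K `&` L = set0,
            lebesgue_measure K = 0%E,
            htop S K = htop S I &
            (0 < htop S I)%E],
        L `<` nonwandering I S &
        hausdorff_dim L = 0%E].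
Proof.
exists 0, (7 / 2), (sysmap R), (@horseshoe R), (@attractor R) => I.
have [hK hI] := htop_horseshoe R.
split; split.
- by lra.
- split; last by move=> _ [x xI <-]; move: xI; rewrite /I /= !in_itv; exact: sysmap_range.
  exact: continuous_subspaceT (@sysmap_continuous R).
- split; last exact: image_horseshoe.
  split; first exact: cantor_horseshoe.
  by move=> x /horseshoe_itv; rewrite /I /= !in_itv /=; lra.
- exact: milnor_attractor.
- exists (@null_solenoids R); split; first exact: null_solenoidsP.
  exact: attractor_closure.
- exact: htop_attractor.
- split; [|exact: measure_horseshoe|by rewrite hK hI|].
  + apply/seteqP; split=> // x [/horseshoe_itv + /attractor_itv] => /=.
    by rewrite in_itv /=; lra.
  + by rewrite /I hI lte_fin ln_gt0 //; lra.
- exact: attractor_nonwandering.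
- exact: hausdorff_dim_attractor.
Qed.
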